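(* For every $t\in[0,1/\mathrm m)$, almost surely $\mathcal C(t)=\{x\in\mathbb R : Y^{(t)}_x> I^{(t)}_x\}\neq\mathbb R$. For every $t\ge 1/\mathrm m$, almost surely $\mathcal C(t)=\mathbb R$.
   Context: Let $\nu$ be a nonzero measure on $(0,\infty)$ with $\mathrm m:=\int_0^\infty l\,\nu(dl)<\infty$. Files $i\in\mathbb N$ have arrival time $t_i\ge 0$, location $x_i\in\mathbb R$ and size $l_i>0$, where $\{(t_i,x_i,l_i): i\in\mathbb N\}$ is a Poisson point process on $[0,\infty)\times\mathbb R\times(0,\infty)$ with intensity $dt\otimes dx\otimes\nu(dl)$. Covering $\mathcal C(t)$: fix $t\ge0$ and list the files with $t_i\le t$ in the order of their labels, relabelled $1,2,\dots$. Put $\mathcal C^{(0)}=\varnothing$ and inductively $\mathcal C^{(n+1)}=\mathcal C^{(n)}\cup[x_{n+1},y_{n+1})$, where $y_{n+1}=\inf\{y\ge x_{n+1} : |\mathcal R^{(n)}\cap[x_{n+1},y)|=l_{n+1}\}$, $\mathcal R^{(n)}=\mathbb R\setminus\mathcal C^{(n)}$ and $|\cdot|$ is Lebesgue measure. Then $\mathcal C(t)=\bigcup_n\mathcal C^{(n)}$. The process $Y^{(t)}=(Y^{(t)}_x)_{x\in\mathbb R}$ is defined by $Y^{(t)}_0=0$ and $Y^{(t)}_b-Y^{(t)}_a=\sum_{i:\,t_i\le t,\;x_i\in(a,b]} l_i-(b-a)$ for $a<b$, and $I^{(t)}_x:=\inf\{Y^{(t)}_y : y\le x\}$. *)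

(* Defs.v *)
From HB Require Import structures.
From mathcomp Require Import all_boot all_order all_algebra.
From mathcomp Require Import all_classical all_reals all_analysis.
From mathcomp Require Import measurable_realfun.
From mathcomp Require Import ring.

Set Implicit Arguments.
Unset Strict Implicit.
Unset Printing Implicit Defensive.

Import Order.TTheory GRing.Theory Num.Theory.
Import numFieldNormedType.Exports.

Local Open Scope classical_set_scope.
Local Open Scope ring_scope.

Section poisson_point_process.
Context {R : realType} {d d' : measure_display}.
Context {Omega : measurableType d} {T : measurableType d'}.
Local Open Scope ereal_scope.

Definition mutually_independent (P : probability Omega R) (n : nat)
    (X : 'I_n -> Omega -> \bar R) : Prop :=
  forall B : 'I_n -> set (\bar R), (forall j, measurable (B j)) ->
  P (\bigcap_(j in [set: 'I_n]) (X j @^-1` B j)) =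
  \prod_(j < n) P (X j @^-1` B j).

(* Points are counted with multiplicity, as labels are counted. *)
Definition point_count (p : nat -> Omega -> T) (A : set T) (w : Omega)
    : \bar R :=
  counting [set i | A (p i w)].

(* No measurability or independence is required of the labelling i |-> p i
   beyond each p i being a random element of T. *)
Record is_poisson_point_process (P : probability Omega R)
    (mu : set T -> \bar R) (p : nat -> Omega -> T) : Prop := {
  ppp_measurable : forall i, measurable_fun [set: Omega] (p i) ;
  ppp_finite : forall (A : set T) (r : R), measurable A -> mu A = r%:E ->
    forall k : nat, P [set w | point_count p A w = k%:R%:E] =
      (expR (- r) * r ^+ k / k`!%:R)%:E ;
  ppp_infinite : forall A : set T, measurable A -> mu A = +oo ->
    P [set w | point_count p A w = +oo] = 1 ;
  ppp_independent : forall (n : nat) (A : 'I_n -> set T),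
    (forall j, measurable (A j)) -> trivIset [set: 'I_n] A ->
    mutually_independent P (fun j => point_count p (A j)) }.

End poisson_point_process.

Section files.
Context {R : realType}.
Local Notation leb := (@lebesgue_measure R).

(* dt (x) dx (x) nu(dl) on [0, +oo) x R x (0, +oo), seen as a measure on R^3;
   nu is meant to be concentrated on (0, +oo).  The library's [\x] is used as
   a set function; it is the product measure as soon as nu is sigma-finite,
   which follows from nu having a finite mean. *)
Definition file_intensity (nu : set R -> \bar R) (A : set (R * R * R))
    : \bar R :=
  ((leb \x leb) \x nu)%E (A `&` [set p | 0 <= p.1.1]).

Definition mean_size (nu : set R -> \bar R) : \bar R :=
  (\int[nu]_(l in `]0%R, +oo[) l%:E)%E.

(* The argument C is the set covered before the file (x, l) is stored.  The
   set below is nonempty whenever C is bounded above, so that the convention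
   inf set0 = 0 plays no role. *)
Definition file_end (C : set R) (x l : R) : R :=
  inf [set y | x <= y /\ leb (~` C `&` `[x, y[) = l%:E].

Definition store_file (C : set R) (f : R * R) : set R :=
  C `|` `[f.1, file_end C f.1 f.2[.

(* Files are given as pairs (location, size), in order of storage. *)
Definition store_files (s : seq (R * R)) : set R := foldl store_file set0 s.

(* The files with t i <= t among the first n labels, listed by increasing
   label; as n grows this exhausts the relabelled list (finite or not). *)
Definition files_upto (ts xs ls : nat -> R) (t : R) (n : nat) : seq (R * R) :=
  [seq (xs i, ls i) | i <- iota 0 n & ts i <= t].

Definition covering (ts xs ls : nat -> R) (t : R) : set R :=
  \bigcup_n store_files (files_upto ts xs ls t n).

Definition arrived_size (ts xs ls : nat -> R) (t a b : R) : \bar R :=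
  \esum_(i in [set i | ts i <= t /\ a < xs i <= b]) (ls i)%:E.

(* The solution of Y 0 = 0, Y b - Y a = arrived_size a b - (b - a); see
   load_increment.  Almost surely arrived_size is finite on bounded intervals,
   so that [fine] loses nothing. *)
Definition load (ts xs ls : nat -> R) (t x : R) : R :=
  if 0 <= x then fine (arrived_size ts xs ls t 0 x) - x
  else - fine (arrived_size ts xs ls t x 0) - x.

(* Extended real, because the infimum is -oo in the overloaded case. *)
Definition load_inf (ts xs ls : nat -> R) (t x : R) : \bar R :=
  ereal_inf [set (load ts xs ls t y)%:E | y in [set y | y <= x]].

Lemma arrived_sizeD ts xs ls t a b c : (forall i, 0 < ls i) ->
  a <= b -> b <= c ->
  arrived_size ts xs ls t a c =
  (arrived_size ts xs ls t a b + arrived_size ts xs ls t b c)%E.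
Proof.
move=> l0 ab bc; rewrite /arrived_size (esumID [set i | xs i <= b]); last first.
  by move=> i _; rewrite lee_fin ltW.
congr (_ + _)%E; congr esum; apply/seteqP; split=> i /=.
- by move=> [[ti /andP[ai _]] ib]; rewrite ai.
- by move=> [ti /andP[ai ib]]; rewrite ai (le_trans ib bc).
- by move=> [[ti /andP[_ ic]] /negP]; rewrite -ltNge => bi; rewrite bi.
- move=> [ti /andP[bi ic]]; rewrite (le_lt_trans ab bi) ic.
  by split=> //; apply/negP; rewrite -ltNge.
Qed.

Lemma load0 ts xs ls t : load ts xs ls t 0 = 0.
Proof.
rewrite /load lexx /arrived_size (_ : [set i | _] = set0) ?esum_set0 ?subr0//.
apply/seteqP; split=> // i /= [_ /andP[h1 h2]].
by move: (lt_le_trans h1 h2); rewrite ltxx.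
Qed.

Lemma load_increment ts xs ls t : (forall i, 0 < ls i) ->
  (forall a b, arrived_size ts xs ls t a b \is a fin_num) ->
  forall a b, a < b ->
  load ts xs ls t b - load ts xs ls t a =
  fine (arrived_size ts xs ls t a b) - (b - a).
Proof.
move=> l0 fS a b ab; rewrite /load.
case: (leP 0 a) => a0; case: (leP 0 b) => b0.
- rewrite (arrived_sizeD _ _ _ l0 a0 (ltW ab)) fineD//; ring.
- by move: (le_lt_trans a0 (lt_trans ab b0)); rewrite ltxx.
- by rewrite (arrived_sizeD _ _ _ l0 (ltW a0) b0) fineD//; ring.
- by rewrite (arrived_sizeD _ _ _ l0 (ltW ab) (ltW b0)) fineD//; ring.
Qed.

End files.

(* Main.v *)
(* Let S(y, x] be the total size of the files in (y, x].  By induction on the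
   number of stored files, for a outside the covered set C the measure of C in
   [a, b) equals S(a, b] if b is not in C and is smaller otherwise; hence x is
   covered iff S(y, x] > x - y for some y < x, first for finitely many files
   and then, by monotonicity, for all of them.  The theorem thus concerns the
   random walk with the i.i.d. steps S(-(j+1), -j] - c, of mean t m - c.  Its
   supremum M satisfies M = max(0, step + M') with M' a copy of M independent of
   the step, and M is a.s. finite or a.s. infinite by a zero-one law.  If
   t m < c < 1 then M is finite, so that Y tends to +oo at -oo and the infimum
   over a half-line leads to an uncovered point; if t m >= 1 = c then M is
   infinite, so that Y is unbounded below at -oo and everything is covered. *)
Require Import Defs.
From HB Require Import structures.
From mathcomp Require Import all_boot all_order all_algebra.
From mathcomp Require Import all_classical all_reals all_analysis.
From mathcomp Require Import measurable_realfun.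
From mathcomp Require Import ring lra.

Import Order.TTheory GRing.Theory Num.Theory.
Import numFieldNormedType.Exports.

Local Open Scope classical_set_scope.
Local Open Scope ring_scope.

Set Implicit Arguments.
Unset Strict Implicit.
Unset Printing Implicit Defensive.

(** * Storing finitely many files *)

(** The obstacle is that the hypotheses speak only of counts of points, while a step of the walk is
    a sum of sizes whose law [nu] is arbitrary. Sizes are therefore rounded down to finitely many
    positive levels, refined as [r] grows. A rounded window is a finite vector of Poisson counts,
    hence countable-valued, and stationarity and independence of blocks of windows reduce to product
    formulas for point masses. They pass to the true windows because the running maximum is monotone
    in every step, so that almost surely the event that it exceeds [k] no longer depends on [r] once
    [r] is large. Only three consequences of the steps being i.i.d. are carried over, the hypotheses
    [M_law], [M_indep] and [x_indep] on the walk. The mean of a step acts through a comparison of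
    the expected maxima started at times 0 and 1; this stands in for a law of large numbers and also
    reaches the critical case t m = 1. *)

Section finite_queue.
Context {R : realType}.
Local Notation leb := (@lebesgue_measure R).
Implicit Types (C : set R) (a b c x y l : R) (s : seq (R * R)).

Definition ileb C a b : R := fine (leb (C `&` `[a, b[)).

Lemma leb_itv_fin C a b : measurable C -> leb (C `&` `[a, b[) \is a fin_num.
Proof.
move=> mC; rewrite ge0_fin_numE//.
apply: (@le_lt_trans _ _ (leb `[a, b[%classic)).
  by apply: le_measure; rewrite ?inE//; exact: measurableI.
by rewrite lebesgue_measure_itv/=; case: ifP => _; rewrite -?EFinB ltry.
Qed.

Lemma ileb_ge0 C a b : 0 <= ileb C a b.
Proof. by rewrite fine_ge0. Qed.

Lemma ilebE C a b : measurable C -> leb (C `&` `[a, b[) = (ileb C a b)%:E.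
Proof. by move=> mC; rewrite fineK// leb_itv_fin. Qed.

Lemma ilebD C a b c : measurable C -> a <= b -> b <= c ->
  ileb C a c = ileb C a b + ileb C b c.
Proof.
move=> mC ab bc; rewrite /ileb -fineD ?leb_itv_fin//; congr fine.
rewrite -measureU//; [|exact: measurableI|exact: measurableI|].
  rewrite -setIUr; congr (leb (C `&` _)).
  by rewrite -itv_bndbnd_setU ?bnd_simp.
rewrite -setIIr (_ : `[a, b[ `&` `[b, c[ = set0) ?setI0//.
apply/seteqP; split => z //=; rewrite !in_itv/= => -[/andP[_ h1] /andP[h2 _]].
by move: (lt_le_trans h1 h2); rewrite ltxx.
Qed.

Lemma ilebxx C a : ileb C a a = 0.
Proof. by rewrite /ileb set_itvco0// setI0 measure0. Qed.

Lemma ilebC C a b : measurable C -> a <= b ->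
  ileb C a b + ileb (~` C) a b = b - a.
Proof.
move=> mC ab; have mC' : measurable (~` C) by exact: measurableC.
rewrite /ileb -fineD ?leb_itv_fin// -measureU//; last 3 first.
- exact: measurableI.
- exact: measurableI.
- by rewrite setIACA setICr set0I.
rewrite -setIUl setUv setTI -[X in fine X]/(leb `[a, b[%classic).
rewrite lebesgue_measure_itv/= lte_fin.
by case: ltgtP ab => // -> _; rewrite subrr.
Qed.

Lemma ileb_le C a b : measurable C -> a <= b -> ileb C a b <= b - a.
Proof. by move=> mC ab; rewrite -(ilebC mC ab) lerDl ileb_ge0. Qed.

Lemma ileb_set0 a b : ileb set0 a b = 0.
Proof. by rewrite /ileb set0I measure0. Qed.

Lemma eq_ileb C D a b : C `&` `[a, b[ = D `&` `[a, b[ -> ileb C a b = ileb D a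
  b.
Proof. by rewrite /ileb => ->. Qed.

Lemma ileb_fill C a x y b : measurable C -> a <= x -> x <= b -> x <= y ->
  ileb (C `|` `[x, y[) a b = ileb C a b + ileb (~` C) x (Num.min y b).
Proof.
move=> mC ax xb xy.
have mC' : measurable (~` C) by exact: measurableC.
have mD : measurable (C `|` `[x, y[) by exact: measurableU.
set z := Num.min y b.
have xz : x <= z by rewrite le_min xy.
have zb : z <= b by rewrite ge_min lexx orbT.
rewrite (ilebD mD ax xb) (ilebD mC ax xb) (ilebD mD xz zb) (ilebD mC xz zb).
rewrite (@eq_ileb (C `|` `[x, y[) C a x); last first.
  apply/seteqP; split => u /=; rewrite !in_itv/=; last by tauto.
  by move=> [[//|/andP[h1 _]] /andP[h2 h3]]; move: (le_lt_trans h1 h3);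
    rewrite ltxx.
rewrite (@eq_ileb (C `|` `[x, y[) C z b); last first.
  apply/seteqP; split => u /=; rewrite !in_itv/=; last by tauto.
  move=> [[//|/andP[h1 h2]] /andP[h3 h4]]; exfalso.
  by move: h3; rewrite leNgt lt_min h2 h4.
have <- : ileb setT x z = ileb (C `|` `[x, y[) x z.
  apply: eq_ileb; apply/seteqP; split => u /=; last by tauto.
  rewrite !in_itv/= => -[_ /andP[h1 h2]]; split; last by rewrite h1.
  by right; rewrite h1/=; move: h2; rewrite lt_min => /andP[].
have -> : ileb setT x z = z - x.
  have := @ilebC setT x z measurableT xz.
  by rewrite setCT ileb_set0 addr0.
rewrite -(ilebC mC xz); lra.
Qed.

(** The free length [phi] of [[x, y[] is nondecreasing and 1-Lipschitz in [y], and grows at unit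
    speed beyond [hi]. So it reaches [l], and by continuity it equals [l] at the first such [y]. The
    proof works with the upper set [l <= phi y] and returns to the equality used in [file_end] only
    at the end. *)
Lemma file_endP C x l hi : measurable C -> (forall u, C u -> u < hi) -> 0 < l ->
  [/\ x < file_end C x l, ileb (~` C) x (file_end C x l) = l &
      forall b, x <= b -> b < file_end C x l -> ileb (~` C) x b < l].
Proof.
move=> mC Chi l0; have mC' : measurable (~` C) by exact: measurableC.
pose phi y := ileb (~` C) x y.
have phi_lip y z : x <= y -> y <= z -> phi y <= phi z <= phi y + (z - y).
  move=> xy yz; rewrite /phi (ilebD mC' xy yz) lerDl ileb_ge0/= lerD2l.
  exact: ileb_le.
pose E := [set y | x <= y /\ l <= phi y].
have E0 : E !=set0.
  pose m := Num.max x hi; exists (m + l).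
  have xm : x <= m by rewrite le_max lexx.
  split; first by rewrite (le_trans xm)// lerDl ltW.
  have ml : m <= m + l by rewrite lerDl ltW.
  rewrite /phi (ilebD mC' xm ml).
  suff -> : ileb (~` C) m (m + l) = l by rewrite lerDr ileb_ge0.
  suff h0 : ileb C m (m + l) = 0 by have := ilebC mC ml; rewrite h0; lra.
  rewrite -(ileb_set0 m (m + l)); apply: eq_ileb.
  apply/seteqP; split => u /=; last by case.
  rewrite !in_itv/= => -[/Chi h1 /andP[h2 _]].
  have : m < hi by exact: le_lt_trans h1.
  by rewrite gt_max ltxx andbF.
have lbE : has_lbound E by exists x => y [].
have hE : has_inf E by exact: conj E0 lbE.
pose y1 := inf E.
have xy1 : x <= y1 by apply: lb_le_inf => // y [].
have below b : x <= b -> b < y1 -> phi b < l.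
  move=> xb by1; rewrite ltNge; apply/negP => lb.
  by move: by1; rewrite ltNge => /negP; apply; apply: (ge_inf lbE).
have ge1 : l <= phi y1.
  apply/ler_addgt0Pr => e e0.
  have [y [xy ly] ye] := inf_adherent e0 hE.
  have y1y : y1 <= y by exact: ge_inf.
  have /andP[_ h] := phi_lip _ _ xy1 y1y.
  apply: (le_trans ly); apply: (le_trans h); rewrite lerD2l lerBlDl; exact: ltW.
have xy1' : x < y1.
  rewrite lt_neqAle xy1 andbT; apply/eqP => xE.
  by move: ge1; rewrite -xE /phi ilebxx leNgt l0.
have le1 : phi y1 <= l.
  apply/ler_addgt0Pr => e e0.
  pose b := Num.max x (y1 - e).
  have xb : x <= b by rewrite le_max lexx.
  have by1 : b < y1 by rewrite gt_max xy1'/= ltrBlDr ltrDl.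
  have /andP[_ h] := phi_lip _ _ xb (ltW by1).
  apply: (le_trans h); apply: lerD; first exact/ltW/below.
  by rewrite lerBlDr -lerBlDl le_max lexx orbT.
have phi1 : phi y1 = l by apply/eqP; rewrite eq_le le1.
have -> : file_end C x l = y1.
  rewrite /file_end; set E' := [set y | _].
  have E'y1 : E' y1 by split=> //; rewrite ilebE// -phi1.
  have E'E : E' `<=` E.
    by move=> y [xy]; rewrite ilebE// => -[yl]; split=> //; rewrite /phi yl.
  apply/eqP; rewrite eq_le; apply/andP; split.
    by apply: ge_inf => //; exists x => y [].
  by apply: lb_le_inf; [exists y1|move=> y /E'E; exact: ge_inf].
by split.
Qed.

Definition total_size s a b : R := \sum_(f <- s | a < f.1 <= b) f.2.

Lemma total_size_rcons s f a b : total_size (rcons s f) a b =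
  total_size s a b + (if a < f.1 <= b then f.2 else 0).
Proof. by rewrite /total_size -cats1 big_cat/= big_cons big_nil; case: ifP;
  rewrite addr0. Qed.

Lemma total_sizeD s a b c : a <= b -> b <= c ->
  total_size s a c = total_size s a b + total_size s b c.
Proof.
move=> ab bc; rewrite /total_size (bigID (fun f => f.1 <= b))/=; congr (_ + _).
- apply: eq_bigl => f; apply/idP/idP => [/andP[/andP[-> _] ->]//|/andP[-> fb]].
  by rewrite fb (le_trans fb).
- apply: eq_bigl => f; rewrite -ltNge; apply/idP/idP => [/andP[/andP[_ ->]
  ->]//|/andP[bf ->]].
  by rewrite bf (le_lt_trans ab bf).
Qed.

(** The inductive invariant. The bound [hi] leaves room for the next file to end, and [lo] provides
    uncovered points [a] to the left of any given point. Nothing is asked for a covered [a], where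
    mass overflowing from the left would spoil the comparison. *)
Definition covers_exactly s C :=
  [/\ measurable C, exists hi, forall u, C u -> u < hi,
      exists lo, forall u, C u -> lo <= u &
      forall a b, ~ C a -> a <= b ->
        (C b -> ileb C a b < total_size s a b) /\
        (~ C b -> ileb C a b = total_size s a b)].

(** A point [a] left uncovered is before [x] or not before [y0], so the new file changes the
    comparison only if [a < x <= b]. Then either it ends by [b] and both sides grow by [l], or it
    runs across [b], which becomes covered while the mass gains less than [l]. *)
Lemma covers_exactly_store s C f : 0 < f.2 ->
  covers_exactly s C -> covers_exactly (rcons s f) (store_file C f).
Proof.
case: f => x l /= l0 [mC [hi Chi] [lo Clo] inv].
have [xy0 phi0 phi_lt] := @file_endP C x l hi mC Chi l0.
rewrite /store_file/=; set y0 := file_end C x l in xy0 phi0 phi_lt *.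
split.
- exact: measurableU.
- exists (Num.max hi y0) => u /= [/Chi h|]; first by rewrite lt_max h.
  by rewrite in_itv/= => /andP[_ h]; rewrite lt_max h orbT.
- exists (Num.min lo x) => u /= [/Clo h|]; first by rewrite ge_min h.
  by rewrite in_itv/= => /andP[h _]; rewrite ge_min h orbT.
move=> a b nCa ab; rewrite total_size_rcons/=.
have nCa' : ~ C a by move=> h; apply: nCa; left.
have nIa : ~ (x <= a < y0) by move=> h; apply: nCa; right; rewrite /= in_itv.
have [h1 h2] := inv a b nCa' ab.
have [bx|xb] := ltP b x.
  rewrite andbF addr0 (@eq_ileb _ C); last first.
    apply/seteqP; split => u /=; rewrite !in_itv/=; last by tauto.
    move=> [[//|/andP[h3 _]] /andP[h4 h5]].
    by move: (le_lt_trans h3 (lt_trans h5 bx)); rewrite ltxx.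
  split; first by move=> [//|]/=; rewrite in_itv/= leNgt bx.
  by move=> h; apply: h2 => h'; apply: h; left.
have [ax|xa] := ltP a x; rewrite /= ?addr0.
  rewrite (ileb_fill mC (ltW ax) xb (ltW xy0)).
  have [y0b|by0] := leP y0 b.
    rewrite phi0 ltrD2r; split.
      by move=> [//|]; rewrite /= in_itv/= ltNge y0b andbF.
    by move=> h; rewrite h2// => h'; apply: h; left.
  split; last by case; right; rewrite /= in_itv/= xb.
  (* Whether or not [b] was covered before, the old mass is at most the old total; the strictness
     comes from the new file alone. *)
  move=> _; apply: ler_ltD; last exact: phi_lt.
  have [/h1/ltW//|/h2->//] := pselect (C b).
have y0a : y0 <= a by rewrite leNgt; apply/negP => h; apply: nIa; rewrite xa.
rewrite (@eq_ileb _ C); last first.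
  apply/seteqP; split => u /=; rewrite !in_itv/=; last by tauto.
  move=> [[//|/andP[_ h3]] /andP[h4 h5]].
  by move: (lt_le_trans h3 (le_trans y0a h4)); rewrite ltxx.
split; first by move=> [//|]/=; rewrite in_itv/= ltNge (le_trans y0a ab) andbF.
by move=> h; apply: h2 => h'; apply: h; left.
Qed.

Lemma store_files_covers s : {in s, forall f, 0 < f.2} ->
  covers_exactly s (store_files s).
Proof.
elim/last_ind: s => [_|s f ih sf].
  split => //=; [exact: measurable0|by exists 0|by exists 0|].
  by move=> a b _ _; split=> // _; rewrite ileb_set0 /total_size big_nil.
rewrite /store_files foldl_rcons; apply: covers_exactly_store.
  by apply: sf; rewrite mem_rcons mem_head.
by apply: ih => g gs; apply: sf; rewrite mem_rcons inE gs orbT.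
Qed.

(** For a covered [x], the witness [y] is an uncovered point close to the supremum of those below
    [x]: from there to [x] almost nothing is free, while the stored size exceeds the local mass by a
    fixed amount. The supremum itself will not do: it is covered, the stored intervals being closed
    on the left. *)
Lemma store_filesP s x : {in s, forall f, 0 < f.2} ->
  store_files s x <-> exists2 y, y < x & x - y < total_size s y x.
Proof.
move=> s0; have [mC _ [lo Clo] inv] := store_files_covers s0.
move: mC Clo inv; set C := store_files s => mC Clo inv.
have mC' : measurable (~` C) by exact: measurableC.
split.
  move=> Cx; pose E := [set a | ~ C a /\ a < x].
  have E0 : E !=set0.
    exists (lo - 1); split; first by move=> /Clo; lra.
    have := Clo _ Cx; lra.
  have ubE : has_ubound E by exists x => a [_ /ltW].
  have hE : has_sup E by exact: conj E0 ubE.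
  have [a0 [nCa0 a0x]] := E0.
  (* the excess of stored over local mass is the same from all uncovered a *)
  pose d a := total_size s a x - ileb C a x.
  have dE a a' : ~ C a -> ~ C a' -> a <= a' -> a' < x -> d a = d a'.
    move=> nCa nCa' aa' a'x; rewrite /d (total_sizeD _ aa' (ltW a'x)).
    rewrite (ilebD mC aa' (ltW a'x)) (inv a a' nCa aa').2//; ring.
  have d0 : 0 < d a0 by rewrite subr_gt0; apply: (inv _ _ nCa0 (ltW a0x)).1.
  (* A distance below [d a0] is enough: the free length of [[a, x[] is at most [sup E - a], and
     [d a = d a0]. *)
  have [a [nCa ax] ga] := sup_adherent d0 hE.
  have da : d a = d a0.
    by have [h|/ltW h] := leP a a0; [apply: dE|symmetry; apply: dE].
  exists a => //.
  have ag : a <= sup E by exact: ub_le_sup.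
  have gx : sup E <= x by apply: ge_sup => // b [_ /ltW].
  have h0 : ileb (~` C) (sup E) x <= 0.
    rewrite /ileb (_ : leb _ = 0%E)//.
    apply: (@subset_measure0 _ _ _ leb _ [set sup E]).
    - exact: measurableI.
    - exact: measurable_set1.
    - move=> u /=; rewrite in_itv/= => -[nCu /andP[gu ux]].
      by apply/eqP; rewrite eq_le gu andbT; apply: ub_le_sup.
    - exact: lebesgue_measure_set1.
  have := ilebC mC (ltW ax); rewrite (ilebD mC' ag gx).
  by have := ileb_le mC' ag; move: da ga h0; rewrite /d; lra.
(* If [x] is uncovered, the comparison starts from an uncovered point: [y], or [lo - 1] when [y] is
   covered. In the latter case size and mass agree up to [x] while the mass falls short up to [y],
   so the files after [y] weigh less than the mass of [[y, x[]. *)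
move=> [y yx h]; apply: contrapT => nCx.
suff : total_size s y x <= x - y by rewrite leNgt h.
have [Cy|nCy] := pselect (C y); last first.
  by rewrite -(inv y x nCy (ltW yx)).2//; apply: ileb_le => //; apply: ltW.
pose a := lo - 1.
have nCa : ~ C a by move=> /Clo; rewrite /a; lra.
have ay : a <= y by have := Clo _ Cy; rewrite /a; lra.
have h1 := (inv a y nCa ay).1 Cy.
have h2 := (inv a x nCa (le_trans ay (ltW yx))).2 nCx.
have := total_sizeD s ay (ltW yx); have := ilebD mC ay (ltW yx).
have := ileb_le mC (ltW yx); lra.
Qed.

End finite_queue.

(** * Coverage by all files, and the load process *)

Lemma lt_nneseries {R : realType} (u : nat -> \bar R) (P : pred nat)
    (c : \bar R) : (forall i, P i -> 0 <= u i)%E ->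
  (c < \sum_(0 <= i <oo | P i) u i)%E ->
  exists n, (c < \sum_(0 <= i < n | P i) u i)%E.
Proof.
move=> u0 cu; apply: contrapT => /forallNP h.
suff : (\sum_(0 <= i <oo | P i) u i <= c)%E by rewrite leNgt cu.
apply: lime_le; first by apply: is_cvg_nneseries => n _; exact: u0.
by apply: nearW => n; rewrite leNgt; apply/negP/h.
Qed.

Section covering_load.
Context {R : realType} (ts xs ls : nat -> R) (t : R).
Hypothesis ls_gt0 : forall i, 0 < ls i.

Local Notation arrived := (arrived_size ts xs ls t).
Local Notation Y := (load ts xs ls t).

Lemma arrived_size_series (a b : R) : arrived a b =
  (\sum_(0 <= i <oo | (ts i <= t)%R && (a < xs i <= b)%R) (ls i)%:E)%E.
Proof.
rewrite nneseries_esum; last by move=> i _; rewrite lee_fin ltW.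
by congr esum; apply/seteqP; split => i /= => [[-> ->]|/andP[-> ->]].
Qed.

Lemma arrived_size_ge0 a b : (0 <= arrived a b)%E.
Proof. by apply: esum_ge0 => i _; rewrite lee_fin ltW. Qed.

Lemma total_size_files_upto n a b :
  (total_size (files_upto ts xs ls t n) a b)%:E =
  (\sum_(0 <= i < n | (ts i <= t)%R && (a < xs i <= b)%R) (ls i)%:E)%E.
Proof.
rewrite /total_size /files_upto big_map/= big_filter_cond/= sumEFin.
by rewrite /index_iota subn0.
Qed.

(** As the inequality is strict, it holds for the series exactly when it holds for a partial sum,
    that is after finitely many labels. *)
Lemma covering_arrived : covering ts xs ls t =
  [set x | exists2 y, y < x & ((x - y)%:E < arrived y x)%E].
Proof.
have pos n : {in files_upto ts xs ls t n, forall f, 0 < f.2}.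
  by move=> f /mapP[i _ ->]; exact: ls_gt0.
apply/seteqP; split => x /=.
  move=> [n _] /(store_filesP _ (pos n))[y yx h]; exists y => //.
  move: h; rewrite -lte_fin total_size_files_upto arrived_size_series.
  move=> /lt_le_trans; apply; apply: nneseries_lim_ge => i _ _.
  by rewrite lee_fin; exact: ltW (ls_gt0 i).
move=> [y yx]; rewrite arrived_size_series => /lt_nneseries[|n].
  by move=> i _; rewrite lee_fin; exact: ltW (ls_gt0 i).
rewrite -total_size_files_upto lte_fin => h.
exists n => //; apply/store_filesP; first exact: pos.
by exists y.
Qed.

Hypothesis arrived_fin : forall a b, arrived a b \is a fin_num.

Let S a b := fine (arrived a b).

Lemma fine_arrivedD a b c : a <= b -> b <= c -> S a c = S a b + S b c.
Proof. by move=> ab bc; rewrite /S (arrived_sizeD _ _ _ _ ab bc)// fineD. Qed.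

Lemma fine_arrived_ge0 a b : 0 <= S a b.
Proof. by rewrite fine_ge0// arrived_size_ge0. Qed.

Lemma loadB a b : a < b -> Y b - Y a = S a b - (b - a).
Proof. exact: load_increment. Qed.

Lemma covering_fine_arrived : covering ts xs ls t =
  [set x | exists2 y, y < x & x - y < S y x].
Proof.
rewrite covering_arrived; apply/seteqP; split => x [y yx] h; exists y => //.
  by rewrite -lte_fin /S fineK.
by move: h; rewrite -lte_fin /S fineK.
Qed.

(** By [loadB], [x - y < S y x] means [Y y < Y x]: a point is covered when [Y] takes a strictly
    lower value to its left. *)
Lemma covering_load : covering ts xs ls t =
  [set x | (load_inf ts xs ls t x < (Y x)%:E)%E].
Proof.
rewrite covering_fine_arrived; apply/seteqP; split => x /=.
  move=> [y yx h]; apply: (@le_lt_trans _ _ (Y y)%:E).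
    by apply: ereal_inf_lbound; exists y => //=; exact: ltW.
  by rewrite lte_fin; have := loadB yx; lra.
move=> /ereal_inf_lt[_ [y /= yx <-]]; rewrite lte_fin => h.
move: yx; rewrite le_eqVlt => /predU1P[yx|yx]; first by move: h;
  rewrite yx ltxx.
by exists y => //; have := loadB yx; lra.
Qed.

Lemma fine_arrived_sum n :
  S (- n%:R) 0 = \sum_(j < n) S (- j.+1%:R) (- j%:R).
Proof.
elim: n => [|n ih]; last first.
  by rewrite big_ord_recr/= -ih addrC -fine_arrivedD ?lerN2 ?ler_nat ?oppr_le0.
rewrite big_ord0 oppr0 /S; apply/eqP; rewrite fine_eq0//.
rewrite /arrived_size (_ : [set i | _] = set0) ?esum_set0//.
apply/seteqP; split => // i /= [_ /andP[h1 h2]].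
by move: (lt_le_trans h1 h2); rewrite ltxx.
Qed.

(** [Y] decreases at unit speed and only jumps upwards. The bound forces it to [+oo] at [-oo], so
    there is a leftmost place [x] where it comes within 1/2 of its infimum [B] on the negative
    half-line. Left of [x] it stays at or above [B + 1 / 2] and at [x] it is at most that, so [x] is
    uncovered. The margin is there because [B] need not be attained; any positive one would do. *)
Lemma covering_neqT (c K : R) : 0 <= c -> c < 1 ->
  (forall n, S (- n%:R) 0 <= K + c * n%:R) -> covering ts xs ls t <> setT.
Proof.
move=> c0 c1 SK.
(* Rounding [- y] up to the integer [n.+1] adds at most one window, hence the extra [c] in the
   constant. *)
have Ylo y : y <= 0 -> (1 - c) * - y - (K + c) <= Y y.
  move=> y0; pose n := Num.truncn (- y).
  have /andP[nlo nhi] : n%:R <= - y < n.+1%:R by apply: truncn_itv; lra.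
  have -> : Y y = - S y 0 - y.
    have [->|ylt] := eqVneq y 0.
      by rewrite load0; have := fine_arrived_sum 0;
        rewrite big_ord0 oppr0 => ->; lra.
    have yl : y < 0 by rewrite lt_neqAle ylt.
    by have := loadB yl; rewrite load0; lra.
  have h1 : S y 0 <= S (- n.+1%:R) 0.
    rewrite (@fine_arrivedD (- n.+1%:R) y)// ?lerDr ?fine_arrived_ge0//; lra.
  have h2 := SK n.+1.
  have h3 : c * n.+1%:R <= c * (- y + 1) by rewrite ler_wpM2l// -natr1 lerD2r.
  lra.
pose A := [set Y y | y in [set y | y <= 0]].
have A0 : A (Y 0) by exists 0 => /=.
have lbA : has_lbound A.
  exists (- (K + c)) => _ [y /= y0 <-].
  have : 0 <= (1 - c) * - y by apply: mulr_ge0; lra.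
  by have := Ylo y y0; lra.
pose B := inf A.
have BY y : y <= 0 -> B <= Y y by move=> y0; apply: ge_inf => //; exists y.
have B0 : B <= 0 by rewrite -(load0 ts xs ls t); exact: BY.
have hA : has_inf A by exact: conj (ex_intro _ _ A0) lbA.
pose T := [set y | y <= 0 /\ Y y < B + 1 / 2].
have T0 : T !=set0.
  have [|_ [y /= y0 <-] h] := @inf_adherent _ A (1 / 2) _ hA; first by lra.
  by exists y.
have lbT : has_lbound T.
  exists (- ((K + c + 1) / (1 - c))) => y [y0 yB]; rewrite leNgt;
    apply/negP => h.
  have h' : K + c + 1 < (1 - c) * - y.
    by rewrite mulrC -ltr_pdivrMr ?subr_gt0//; lra.
  by have := Ylo y y0; lra.
have hT : has_inf T by exact: conj T0 lbT.
pose x := inf T.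
have xz z : T z -> x <= z by move=> Tz; exact: ge_inf.
have x0 : x <= 0 by have [z Tz] := T0; apply: le_trans (xz z Tz) _; case: Tz.
(* From [x] to a nearby [z] in [T] the load loses at most [z - x], so the bound on [Y z] passes to
   the infimum [x]. *)
have YxB : Y x <= B + 1 / 2.
  apply/ler_addgt0Pr => e e0.
  have [z Tz ze] := inf_adherent e0 hT.
  have := xz z Tz; case: Tz => z0 Yz; rewrite -/x in ze.
  rewrite le_eqVlt => /predU1P[->|xltz]; first lra.
  by have := loadB xltz; have := fine_arrived_ge0 x z; lra.
move=> covT; have : covering ts xs ls t x by rewrite covT.
rewrite covering_fine_arrived => -[y yx h].
have Yy : B + 1 / 2 <= Y y.
  rewrite leNgt; apply/negP => Yy.
  have : T y by split => //; lra.
  by move/xz; lra.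
by have := loadB yx; lra.
Qed.

(** With [- m < x], all files located between [-n] and [-m] lie to the left of [x]. They weigh
    [S (- n%:R) 0 - S (- m%:R) 0], so a surplus of [S (- m%:R) 0 + |x|] at [-n] leaves more than the
    distance from [-n] to [x]. *)
Lemma covering_eqT : (forall K, exists n : nat, K + n%:R < S (- n%:R) 0) ->
  covering ts xs ls t = setT.
Proof.
move=> SK; rewrite covering_fine_arrived; apply/seteqP; split => // x _ /=.
pose m := (Num.truncn `|x|).+1.
have mx : `|x| < m%:R by exact: truncnS_gt.
have [n nS] := SK (S (- m%:R) 0 + `|x|).
have x1 := ler_norm x; have x2 := ler_norm (- x); rewrite normrN in x2.
have mn : (m <= n)%N.
  rewrite leqNgt; apply/negP => nm.
  have nm' : (n%:R : R) <= m%:R by rewrite ler_nat ltnW.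
  have n0 : (0 : R) <= n%:R by [].
  have := @fine_arrivedD (- m%:R) (- n%:R) 0;
    have := fine_arrived_ge0 (- m%:R) (- n%:R).
  by lra.
have mn' : (m%:R : R) <= n%:R by rewrite ler_nat.
exists (- n%:R); first by lra.
have := @fine_arrivedD (- n%:R) (- m%:R) 0;
  have := @fine_arrivedD (- n%:R) (- m%:R) x.
have := fine_arrived_ge0 (- m%:R) x.
by lra.
Qed.

End covering_load.

(** * Independent events *)

Section events.
Context {d : measure_display} {T : measurableType d} {R : realType}.
Variable P : probability T R.
Implicit Types (A B : set T) (F : nat -> set T).

Definition independent_events A B := P (A `&` B) = (P A * P B)%E.

Lemma independent_eventsC A B : measurable A -> measurable B ->
  independent_events A B -> independent_events A (~` B).
Proof.
move=> mA mB AB; rewrite /independent_events probability_setC//.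
rewrite -setDE measureD//; last by rewrite ltey_eq fin_num_measure.
transitivity (P A - P A * P B)%E; first by rewrite -AB.
by rewrite muleBr ?mule1 ?fin_num_measure.
Qed.

Lemma independent_events_sym A B :
  independent_events A B -> independent_events B A.
Proof. by rewrite /independent_events setIC muleC. Qed.

Lemma independent_events_bigcup A F : measurable A ->
  (forall n, measurable (F n)) -> {homo F : m n / (m <= n)%N >-> m `<=` n} ->
  (forall n, independent_events A (F n)) ->
  independent_events A (\bigcup_n F n).
Proof.
move=> mA mF ndF AF; rewrite /independent_events setI_bigcupr.
have mUF : measurable (\bigcup_n F n) by exact: bigcup_measurable.
have cF : P (F n) @[n --> \oo] --> P (\bigcup_n F n).
  by apply: nondecreasing_cvg_mu => // m n mn; apply/subsetPset/ndF.
have cAF : (P A * P (F n))%E @[n --> \oo] --> P (\bigcup_n (A `&` F n)).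
  rewrite [X in X @ _ --> _](_ : _ = P \o (fun n => A `&` F n)); last first.
    by apply/funext => n; rewrite -AF.
  apply: nondecreasing_cvg_mu => //.
  - by move=> n; exact: measurableI.
  - by apply: bigcup_measurable => n _; exact: measurableI.
  - by move=> m n mn; apply/subsetPset; apply: setIS; exact: ndF.
apply: (cvg_unique _ cAF) => //.
by apply: cvgeZl => //; exact: fin_num_measure.
Qed.

Lemma independent_events_bigcap A F : measurable A ->
  (forall n, measurable (F n)) -> {homo F : m n / (m <= n)%N >-> n `<=` m} ->
  (forall n, independent_events A (F n)) ->
  independent_events A (\bigcap_n F n).
Proof.
move=> mA mF niF AF; rewrite -[\bigcap_n F n]setCK setC_bigcap.
apply: independent_eventsC => //.
  by apply: bigcup_measurable => n _; exact: measurableC.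
apply: independent_events_bigcup => //.
- by move=> n; exact: measurableC.
- by move=> m n mn; apply: subsetC; exact: niF.
- by move=> n; exact: independent_eventsC.
Qed.

Lemma ae_iff_measure A B : measurable A -> measurable B ->
  {ae P, forall w, A w <-> B w} -> P A = P B.
Proof.
move=> mA mB AB; rewrite -[A]setIT -[B]setIT -!integral_indic//.
apply: ae_eq_integral => //.
- by apply/measurable_EFinP; exact: measurable_indic.
- by apply/measurable_EFinP; exact: measurable_indic.
apply: filterS AB => w AB _; rewrite !indicE; congr (_%:R%:E).
by congr nat_of_bool; apply/idP/idP; rewrite !inE => /AB.
Qed.

(** Dominated convergence for indicators. The index from which [E r] and [A] agree may depend on
    [w]. *)
Lemma measure_cvg_ae (E : nat -> set T) A : (forall r, measurable (E r)) ->
  measurable A -> {ae P, forall w, \forall r \near \oo, E r w <-> A w} ->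
  P (E r) @[r --> \oo] --> P A.
Proof.
move=> mE mA EA.
have PI B : measurable B -> P B = (\int[P]_w (\1_B w)%:E)%E.
  by move=> mB; rewrite integral_indic// setIT.
rewrite (_ : (fun r => _) = (fun r => \int[P]_w (\1_(E r) w)%:E)%E); last first.
  by apply/funext => r; exact: PI.
rewrite (PI _ mA).
have [|||||_ _ //] := @dominated_convergence _ _ _ P setT measurableT
    (fun r w => (\1_(E r) w)%:E) (fun w => (\1_A w)%:E) (EFin \o cst 1).
- by move=> r; apply/measurable_EFinP; exact: measurable_indic.
- by apply/measurable_EFinP; exact: measurable_indic.
- apply: filterS EA => w EA _; apply: cvg_near_cst; apply: filterS EA => r EA.
  rewrite !indicE; congr (_%:R%:E).
  by congr nat_of_bool; apply/idP/idP; rewrite !inE => /EA.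
- exact: finite_measure_integrable_cst.
- by apply: aeW => w r _; rewrite lee_fin indicE ger0_norm// lern1 leq_b1.
Qed.

(** Carries independence from the events of the rounded walk to those of the true one. *)
Lemma independent_events_cvg_ae (E F : nat -> set T) A B :
  (forall r, measurable (E r)) -> (forall r, measurable (F r)) ->
  measurable A -> measurable B ->
  {ae P, forall w, \forall r \near \oo, E r w <-> A w} ->
  {ae P, forall w, \forall r \near \oo, F r w <-> B w} ->
  (forall r, independent_events (E r) (F r)) -> independent_events A B.
Proof.
move=> mE mF mA mB EA FB EF.
have cE := measure_cvg_ae mE mA EA; have cF := measure_cvg_ae mF mB FB.
have cEF : P (E r `&` F r) @[r --> \oo] --> P (A `&` B).
  apply: measure_cvg_ae => [r||]; [exact: measurableI|exact: measurableI|].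
  apply: filterS2 EA FB => w; apply: filterS2 => r EA FB.
  by split => -[? ?]; split; [apply/EA|apply/FB|apply/EA|apply/FB].
rewrite (_ : (fun r => _) = fun r => (P (E r) * P (F r))%E) in cEF; last first.
  by apply/funext => r; exact: EF.
apply: (cvg_unique _ cEF) => //; apply: cvgeM => //.
by rewrite mule_def_fin// fin_num_measure.
Qed.

(** The mean of a nonnegative variable is the integral of its tail, so equality in law is needed
    only through the events [k < X]. *)
Lemma eq_ccdf_integral (X Y : T -> R) :
  measurable_fun setT X -> measurable_fun setT Y ->
  (forall w, 0 <= X w) -> (forall w, 0 <= Y w) ->
  (forall k, P [set w | k < X w] = P [set w | k < Y w]) ->
  (\int[P]_w (X w)%:E = \int[P]_w (Y w)%:E)%E.
Proof.
move=> mX mY X0 Y0 XY.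
pose X' : {RV P >-> R} := HB.pack X (@isMeasurableFun.Build _ _ T R X mX).
pose Y' : {RV P >-> R} := HB.pack Y (@isMeasurableFun.Build _ _ T R Y mY).
have := @ge0_expectation_ccdf _ _ _ P X' X0.
have := @ge0_expectation_ccdf _ _ _ P Y' Y0.
rewrite !unlock /= => -> ->; apply: eq_integral => r _.
rewrite /ccdf /distribution /pushforward.
rewrite (_ : X' @^-1` _ = [set w | r < X w]); last first.
  by apply/seteqP; split => w /=; rewrite in_itv/= andbT.
rewrite (_ : Y' @^-1` _ = [set w | r < Y w])//.
by apply/seteqP; split => w /=; rewrite in_itv/= andbT.
Qed.

Lemma ae_eq0_integral_le0 (f : T -> R) : measurable_fun setT f ->
  {ae P, forall w, 0 <= f w} -> (\int[P]_w (f w)%:E <= 0)%E ->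
  {ae P, forall w, f w = 0}.
Proof.
move=> mf f0 If.
have mEf : measurable_fun setT (EFin \o f) by exact/measurable_EFinP.
have I0 : (\int[P]_w `|(f w)%:E| = 0)%E.
  apply/eqP; rewrite eq_le integral_ge0// andbT; apply: le_trans If.
  rewrite (@ae_eq_integral _ _ _ _ _ (EFin \o f))//.
    exact: measurableT_comp.
  by apply: filterS f0 => w fw _; rewrite /= ger0_norm.
have /ae_eq_integral_abs := I0.
move=> /(_ measurableT mEf); apply: filterS => w /(_ I)[].
done.
Qed.

End events.

(** * Random walks *)

Section lindley.
Context {R : realType} (c : R).
Implicit Types (u v : nat -> R).

(* The running maximum of the walk with steps u j - c started at time N, by
   Lindley's recursion. *)
Fixpoint lindley u (n N : nat) : R :=
  if n is m.+1 then Num.max 0 (u N - c + lindley u m N.+1) else 0.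

Lemma lindley_ge0 u n N : 0 <= lindley u n N.
Proof. by case: n => //= n; rewrite le_max lexx. Qed.

Lemma lindley_nd u N : {homo (lindley u)^~ N : m n / (m <= n)%N >-> m <= n}.
Proof.
have step n : forall N, lindley u n N <= lindley u n.+1 N.
  elim: n => [|n ih] M; first by rewrite [X in X <= _]/= lindley_ge0.
  rewrite [X in X <= _]/= [X in _ <= X]/= ge_max le_max lexx/= le_max lerD2l.
  by apply/orP; right; exact: ih.
by move=> m n /subnK <-; elim: (n - m)%N => // k ih; exact: le_trans (step _ _).
Qed.

Lemma lindley_le u v n N : (forall j, u j <= v j) ->
  lindley u n N <= lindley v n N.
Proof.
move=> uv; elim: n N => //= n ih N.
rewrite ge_max le_max lexx/= le_max; apply/orP; right.
by apply: lerD => //; apply: lerB.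
Qed.

Lemma eq_lindley u v n N M : (forall j, (j < n)%N -> u (N + j)%N = v (M +
  j)%N) ->
  lindley u n N = lindley v n M.
Proof.
elim: n N M => //= n ih N M uv.
have := uv 0%N; rewrite !addn0 => -> //; congr (Num.max 0 (_ + _)).
by apply: ih => j jn; rewrite !addSnnS uv.
Qed.

Lemma sum_shiftS u n N :
  \sum_(j < n.+1) u (N + j)%N = u N + \sum_(j < n) u (N.+1 + j)%N.
Proof.
rewrite big_ord_recl addn0; congr (_ + _).
by apply: eq_bigr => j _; rewrite addSnnS.
Qed.

Lemma lindley_ge_sum u n N :
  \sum_(j < n) u (N + j)%N - c * n%:R <= lindley u n N.
Proof.
elim: n N => [|n ih] N; first by rewrite big_ord0/= mulr0 subr0.
rewrite sum_shiftS /= le_max; apply/orP; right; have := ih N.+1.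
by rewrite -natr1 mulrDr mulr1; lra.
Qed.

(** The maximum is attained by some partial sum, the empty one accounting for the value 0. An
    infinite supremum thus yields partial sums above any level. *)
Lemma lindley_sum u n N :
  exists k, lindley u n N = \sum_(j < k) u (N + j)%N - c * k%:R.
Proof.
elim: n N => [|n ih] N; first by exists 0%N; rewrite big_ord0/= mulr0 subr0.
rewrite /=; case: leP => _; first last.
  by exists 0%N; rewrite big_ord0/= mulr0 subr0.
have [k ->] := ih N.+1; exists k.+1; rewrite sum_shiftS.
by rewrite -natr1 mulrDr mulr1; lra.
Qed.

Definition lindley_sup u N : \bar R :=
  ereal_sup [set (lindley u n N)%:E | n in setT].

Lemma lindley_le_sup u n N : ((lindley u n N)%:E <= lindley_sup u N)%E.
Proof. by apply: ereal_sup_ubound; exists n. Qed.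

Lemma lindley_sup_ge0 u N : (0 <= lindley_sup u N)%E.
Proof. exact: le_trans (lindley_le_sup u 0 N). Qed.

Lemma lt_lindley_sup u N (k : \bar R) :
  (k < lindley_sup u N)%E <-> exists n, (k < (lindley u n N)%:E)%E.
Proof.
split=> [/ereal_sup_gt[_ [n _ <-] kn]|[n kn]]; first by exists n.
exact: lt_le_trans (lindley_le_sup u n N).
Qed.

Lemma lindley_supS u N :
  lindley_sup u N = Order.max 0%E ((u N - c)%:E + lindley_sup u N.+1)%E.
Proof.
apply/eqP; rewrite eq_le; apply/andP; split.
  apply: ub_ereal_sup => _ [[|n] _ <-]; first by rewrite /= le_max lexx.
  rewrite [lindley _ _ _]/= EFin_max ge_max !le_max lexx/=.
  by apply/orP; right; rewrite EFinD leeD2l// lindley_le_sup.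
rewrite ge_max lindley_sup_ge0/= addeC -leeBrDr//.
apply: ub_ereal_sup => _ [n _ <-]; rewrite leeBrDr//.
apply: le_trans (lindley_le_sup u n.+1 N).
by rewrite -EFinD lee_fin /= le_max addrC lexx orbT.
Qed.

(** One finite step cannot change whether the supremum is infinite; this is what makes unboundedness
    a tail event. *)
Lemma lindley_supy u N : lindley_sup u N = +oo%E <-> lindley_sup u 0 = +oo%E.
Proof.
elim: N => // N <-; rewrite [in X in _ <-> X]lindley_supS.
have := lindley_sup_ge0 u N.+1; case: (lindley_sup u N.+1) => [r _|_|//];
  last first.
  by split=> // _; rewrite addey// maxey.
by split=> //; rewrite -EFinD; case: (leP 0%E).
Qed.

Lemma lindley_sup_cvg u N : (lindley u n N)%:E @[n --> \oo] --> lindley_sup u N.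
Proof.
apply: ereal_nondecreasing_cvgn => m n mn; rewrite lee_fin.
exact: lindley_nd.
Qed.

Lemma lindley_cvg (u : nat -> nat -> R) v n N :
  (forall j, u r j @[r --> \oo] --> v j) ->
  lindley (u r) n N @[r --> \oo] --> lindley v n N.
Proof.
move=> uv; elim: n N => [|n ih] N /=; first exact: cvg_cst.
have z_cvg : u r N - c + lindley (u r) n N.+1 @[r --> \oo] -->
    v N - c + lindley v n N.+1.
  by apply: cvgD (ih _); apply: cvgB (uv N) _; exact: cvg_cst.
rewrite maxr_absE; under eq_fun do rewrite maxr_absE.
apply: cvgM; last exact: cvg_cst.
apply: cvgD; first by apply: cvgD => //; exact: cvg_cst.
by apply: cvg_norm; apply: cvgB => //; exact: cvg_cst.
Qed.

(** Monotonicity matters at [k = l]: approximation from below never exceeds the limit, whereas mere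
    convergence would leave [k < u r] undecided there. *)
Lemma lt_nd_cvg (u : nat -> R) (l k : R) : nondecreasing_seq u ->
  u r @[r --> \oo] --> l -> \forall r \near \oo, k < u r <-> k < l.
Proof.
move=> ndu uv.
have u_le r : u r <= l.
  rewrite -(cvg_lim _ uv)//; apply: nondecreasing_cvgn_le => //.
  by apply/cvg_ex; exists l.
have [kv|vk] := ltP k l.
  by apply: filterS (cvgr_gt _ uv _ kv) => r ->.
by apply: nearW => r; split => // kr; move: (lt_le_trans kr (u_le r));
  rewrite ltNge vk.
Qed.

End lindley.

(** * Dichotomy for the supremum of the walk *)

Section walk.
Context {d : measure_display} {T : measurableType d} {R : realType}.
Variables (P : probability T R) (c : R) (x : nat -> T -> R).
Hypothesis mx : forall j, measurable_fun setT (x j).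
Hypothesis ix : forall j, P.-integrable setT (EFin \o x j).

Local Notation M n N w := (lindley c (x^~ w) n N).
Local Notation S N w := (lindley_sup c (x^~ w) N).

Hypothesis M_law : forall n k,
  P [set w | k < M n 1 w] = P [set w | k < M n 0 w].
Hypothesis M_indep : forall N n k k',
  independent_events P [set w | k < M N 0 w] [set w | k' < M n N w].
Hypothesis x_indep : forall n a k,
  independent_events P [set w | a < x 0 w] [set w | k < M n 1 w].

Lemma measurable_lindley n N : measurable_fun setT (fun w => M n N w).
Proof.
elim: n N => [|n ih] N /=; first exact: measurable_cst.
apply: measurable_maxr => //; apply: measurable_funD => //.
exact: measurable_funB.
Qed.

Lemma integrable_lindley n N : P.-integrable setT (fun w => (M n N w)%:E).
Proof.
elim: n N => [|n ih] N /=; first exact: finite_measure_integrable_cst.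
apply: (@le_integrable _ _ _ _ _ _ _ (fun w => (x N w - c + M n N.+1 w)%:E))
  => //.
- by apply/measurable_EFinP; exact: (measurable_lindley n.+1 N).
- move=> w _; rewrite lee_fin ger0_norm ?le_max ?lexx// ge_max normr_ge0/=.
  exact: ler_norm.
- under eq_fun do rewrite EFinD EFinB.
  apply: integrableD => //; apply: integrableB => //; first exact: ix.
  exact: finite_measure_integrable_cst.
Qed.

Lemma measurable_lindley_sup N : measurable_fun setT (fun w => S N w).
Proof.
apply: (@emeasurable_fun_cvg _ _ _ _ (fun n w => (M n N w)%:E)).
  by move=> n; apply/measurable_EFinP; exact: measurable_lindley.
by move=> w _; exact: lindley_sup_cvg.
Qed.

Lemma measurable_lt_lindley k n N : measurable [set w | k < M n N w].
Proof.
rewrite -[X in measurable X]setTI.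
rewrite (_ : [set w | _] = (fun w => M n N w) @^-1` `]k, +oo[); last first.
  by apply/seteqP; split => w /=; rewrite in_itv/= andbT.
exact: measurable_lindley.
Qed.

Let U := [set w | S 0 w = +oo%E].

(** The freedom in [N] serves the zero-one law: [U] is expressed by the walk started at time [N],
    which is independent of the maximum over the first [N] steps. *)
Lemma unboundedE N : U = \bigcap_k \bigcup_n [set w | k%:R < M n N w].
Proof.
apply/seteqP; split => w /=.
  move=> /(lindley_supy _ _ N) SN k _.
  have [|n kn] := (lt_lindley_sup c (x^~ w) N k%:R%:E).1;
    first by rewrite SN ltry.
  by exists n.
move=> kn; apply/(lindley_supy _ _ N)/eqyP => A A0.
have [n _ h] := kn (Num.truncn A).+1 I.
apply: ltW; apply: lt_le_trans (lindley_le_sup _ _ n N).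
by rewrite lte_fin; apply: lt_trans h; exact: truncnS_gt.
Qed.

Lemma measurable_unbounded : measurable U.
Proof.
rewrite (unboundedE 0); apply: bigcap_measurableType => k _.
by apply: bigcup_measurable => n _; exact: measurable_lt_lindley.
Qed.

(** [U] is independent of every event [k < M N 0], by its expression from time [N], and is itself
    built from such events, by its expression from time 0; hence it is independent of itself. All
    unions and intersections involved are monotone, so limits of probabilities suffice. *)
Lemma walk_zero_one : P U = 0%E \/ P U = 1%E.
Proof.
have mU := measurable_unbounded.
have ndM N (k : R) : {homo (fun n => [set w | k < M n N w]) :
    m n / (m <= n)%N >-> m `<=` n}.
  by move=> m n mn w /= /lt_le_trans; apply; exact: lindley_nd.
have niM N : {homo (fun k : nat => \bigcup_n [set w | k%:R < M n N w]) :
    m n / (m <= n)%N >-> n `<=` m}.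
  move=> m n mn w [i _ /= h]; exists i => //=; apply: le_lt_trans h.
  by rewrite ler_nat.
have mM N (k : R) : measurable (\bigcup_n [set w | k < M n N w]).
  by apply: bigcup_measurable => n _; exact: measurable_lt_lindley.
have indep1 N (k : R) : independent_events P [set w | k < M N 0 w] U.
  rewrite (unboundedE N); apply: independent_events_bigcap => //.
    exact: measurable_lt_lindley.
  move=> k'; apply: independent_events_bigcup => //.
  - exact: measurable_lt_lindley.
  - by move=> n; exact: measurable_lt_lindley.
have : independent_events P U U.
  rewrite [X in independent_events _ _ X](unboundedE 0).
  apply: independent_events_bigcap => //.
  move=> k; apply: independent_events_bigcup => //.
  - by move=> n; exact: measurable_lt_lindley.
  - by move=> n; apply: independent_events_sym.
rewrite /independent_events setIid.
have : P U \is a fin_num by exact: fin_num_measure.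
move: (P U) => [r _|//|//] [] /eqP; rewrite -subr_eq0 -{1}[r]mulr1 -mulrBr.
rewrite mulf_eq0 subr_eq0 => /orP[/eqP->|/eqP<-]; by [left|right].
Qed.

Let U_lindley1 w : U w -> forall r, exists n, r < M n 1 w.
Proof.
move=> /(lindley_supy _ _ 1) Sw r.
by have [|n] := (lt_lindley_sup c (x^~ w) 1 r%:E).1; [rewrite Sw ltry|exists n].
Qed.

Let mean_lindley n :
  (\int[P]_w (M n 1 w)%:E = \int[P]_w (M n 0 w)%:E)%E.
Proof.
by apply: eq_ccdf_integral => //;
  [exact: measurable_lindley|exact: measurable_lindley|
   move=> w; exact: lindley_ge0|move=> w; exact: lindley_ge0].
Qed.

Let mean_xBc : (\int[P]_w (x 0 w - c)%:E = (\int[P]_w x 0 w)%R%:E - c%:E)%E.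
Proof.
under eq_integral do rewrite EFinB.
rewrite integralB_EFin//; last exact: finite_measure_integrable_cst.
rewrite integral_cst//= probability_setT mule1; congr (_ + _)%E.
by rewrite fineK// integrable_fin_num//; exact: ix.
Qed.

Let integrable_xBc : P.-integrable setT (fun w => (x 0 w - c)%:E).
Proof.
under eq_fun do rewrite EFinB.
by apply: integrableB => //; [exact: ix|exact: finite_measure_integrable_cst].
Qed.

(** If the supremum were almost surely infinite, [f n w], the maximum of [- M n 1 w] and
    [x 0 w - c], would eventually equal [x 0 w - c], and it is dominated by [|x 0 w - c|]. But by
    [M_law] its mean is that of [M n.+1 0 - M n 0], which is nonnegative, so in the limit [x 0]
    would have mean at least [c]. *)
Lemma walk_bounded : \int[P]_w x 0 w < c -> P U = 0%E.
Proof.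
move=> xc; have [//|U1] := walk_zero_one; exfalso.
have aeU : {ae P, forall w, U w}.
  exists (~` U); split => //; first exact/measurableC/measurable_unbounded.
  by rewrite probability_setC ?U1 ?subee//; exact: measurable_unbounded.
pose f n w := M n.+1 0 w - M n 1 w.
have fE n w : f n w = Num.max (- M n 1 w) (x 0 w - c).
  by rewrite /f /=; case: leP => h1; case: leP => h2; lra.
have [|||||_ _ /=] := @dominated_convergence _ _ _ P setT measurableT
    (fun n w => (f n w)%:E) (fun w => (x 0 w - c)%:E)
    (fun w => `|x 0 w - c|%:E).
- move=> n; apply/measurable_EFinP; apply: measurable_funB;
    exact: measurable_lindley.
- by apply/measurable_EFinP; exact: measurable_funB.
- apply: filterS aeU => w Uw _; apply: cvg_near_cst.
  have [n0 h] := U_lindley1 Uw (c - x 0 w).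
  exists n0 => // n /= n0n; congr _%:E; rewrite fE.
  have /= hn := @lindley_nd _ c (x^~ w) 1 _ _ n0n.
  by case: (leP (- M n 1 w)) => //; lra.
- exact: integrable_norm.
- apply: aeW => w n _; rewrite lee_fin fE.
  have := lindley_ge0 c (x^~ w) n 1.
  case: (leP (- M n 1 w)) => // h1 h2.
  by rewrite normrN ger0_norm// ler0_norm; lra.
move=> cvf.
suff : (0 <= \int[P]_w (x 0 w - c)%:E)%E.
  by rewrite mean_xBc -EFinB lee_fin; lra.
rewrite -(cvg_lim _ cvf)//; apply: lime_ge; first by apply/cvg_ex; eexists;
  exact: cvf.
apply: nearW => n; rewrite /f; under eq_integral do rewrite EFinB.
rewrite integralB_EFin; [|by []|exact: integrable_lindley|exact:
  integrable_lindley].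
rewrite mean_lindley sube_ge0; last first.
  by rewrite integrable_fin_num//; exact: integrable_lindley.
apply: ge0_le_integral => //.
- by move=> w _; rewrite lee_fin lindley_ge0.
- by apply/measurable_EFinP; exact: measurable_lindley.
- by apply/measurable_EFinP; exact: (measurable_lindley n.+1).
- by move=> w _; rewrite lee_fin; exact: lindley_nd.
Qed.

Let lindley_sup_law (k : R) :
  P [set w | (k%:E < S 1 w)%E] = P [set w | (k%:E < S 0 w)%E].
Proof.
have SE N : [set w | (k%:E < S N w)%E] = \bigcup_n [set w | k < M n N w].
  apply/seteqP; split => w /=.
    by move=> /lt_lindley_sup[n]; rewrite lte_fin => kn; exists n.
  by move=> [n _ /= kn]; apply/lt_lindley_sup; exists n; rewrite lte_fin.
have cvS N : P [set w | k < M n N w] @[n --> \oo] -->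
    P (\bigcup_n [set w | k < M n N w]).
  apply: nondecreasing_cvg_mu => //.
  - by move=> n; exact: measurable_lt_lindley.
  - by apply: bigcup_measurable => n _; exact: measurable_lt_lindley.
  - move=> m n mn; apply/subsetPset => w /= /lt_le_trans; apply.
    exact: lindley_nd.
have cv1 := cvS 1%N; have cv0 := cvS 0%N.
rewrite (_ : (fun n => _) = fun n => P [set w | k < M n 1 w]) in cv0.
  by rewrite !SE; exact: cvg_unique cv1 cv0.
by apply/funext => n; rewrite M_law.
Qed.

(** The supremum need not be integrable; capped at [K] it has a mean, and the cap preserves the
    equality of laws. *)
Let trunc_sup (K N : nat) w : R := fine (Order.min (S N w) K%:R%:E).

Let trunc_supE K N w : (trunc_sup K N w)%:E = Order.min (S N w) K%:R%:E.
Proof.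
rewrite /trunc_sup fineK// fin_numE.
have := lindley_sup_ge0 c (x^~ w) N.
by case: (S N w) => // r _; rewrite -EFin_min.
Qed.

Let trunc_sup_ge0 K N w : 0 <= trunc_sup K N w.
Proof. by rewrite -lee_fin trunc_supE le_min lindley_sup_ge0/= lee_fin. Qed.

Let measurable_trunc_sup K N : measurable_fun setT (trunc_sup K N).
Proof.
apply: (@measurableT_comp _ _ _ _ _ _ (@fine R)) => //.
by apply: measurable_mine => //; exact: measurable_lindley_sup.
Qed.

Let mean_trunc_sup K :
  (\int[P]_w (trunc_sup K 1 w)%:E = \int[P]_w (trunc_sup K 0 w)%:E)%E.
Proof.
have tS N (k : R) : [set w | k < trunc_sup K N w] =
    if k < K%:R then [set w | (k%:E < S N w)%E] else set0.
  have -> : [set w | k < trunc_sup K N w] =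
      [set w | (k%:E < S N w)%E /\ k < K%:R].
    apply/seteqP; split=> w /=.
      by rewrite -lte_fin trunc_supE lt_min => /andP[].
    by move=> [kS kK]; rewrite -lte_fin trunc_supE lt_min kS lte_fin.
  by case: ifPn => kK; apply/seteqP; split => w //=; case.
apply: eq_ccdf_integral.
- exact: measurable_trunc_sup.
- exact: measurable_trunc_sup.
- by move=> w; exact: trunc_sup_ge0.
- by move=> w; exact: trunc_sup_ge0.
- by move=> k; rewrite !tS; case: ifP.
Qed.

Let trunc_sup_fin K N w r : S N w = r%:E -> trunc_sup K N w = Num.min r K%:R.
Proof. by rewrite /trunc_sup => ->; rewrite -EFin_min. Qed.

(* If the supremum M_0 of the walk were finite, then M_0 and the supremum M_1
   of the shifted walk would have the same law, hence E(M_0 - M_1) = 0 by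
   truncation, although M_0 - M_1 >= x_0 - c has nonnegative mean.  Therefore
   M_0 = M_1 + x_0 - c >= 0 almost surely; as x_0 - c <= - e has positive
   probability and is independent of M_1, no bound on M_1 is possible. *)
Lemma walk_unbounded : c <= \int[P]_w x 0 w -> P [set w | c < x 0 w] <> 0%E ->
  P U = 1%E.
Proof.
move=> cx xc0; have [U0|//] := walk_zero_one; exfalso.
have aeF : {ae P, forall w, exists r0 r1 : R, S 0 w = r0%:E /\ S 1 w = r1%:E}.
  exists U; split => //; first exact: measurable_unbounded.
  move=> w /= h; apply: contrapT => NU; apply: h.
  have S0 : S 0 w != +oo%E by apply/eqP.
  have S1 : S 1 w != +oo%E by apply/eqP => /lindley_supy /eqP;
    rewrite (negbTE S0).
  have := lindley_sup_ge0 c (x^~ w) 0; have := lindley_sup_ge0 c (x^~ w) 1.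
  by move: S0 S1; case: (S 0 w) => // r0; case: (S 1 w) => // r1; exists r0, r1.
pose xi w := x 0 w - c.
have stepE w r0 r1 : S 0 w = r0%:E -> S 1 w = r1%:E ->
    0 <= r1 /\ r0 = Num.max 0 (xi w + r1).
  move=> S0 S1; have := lindley_sup_ge0 c (x^~ w) 1.
  have := lindley_supS c (x^~ w) 0; rewrite S0 S1 lee_fin.
  by rewrite -EFinD -EFin_max => -[] ->.
pose H w := fine (S 0 w) - fine (S 1 w).
have mS N : measurable_fun setT (fun w => fine (S N w)).
  apply: (@measurableT_comp _ _ _ _ _ _ (@fine R)) => //.
  exact: measurable_lindley_sup.
have mH : measurable_fun setT H by exact: measurable_funB.
have iT K N : P.-integrable setT (fun w => (trunc_sup K N w)%:E).
  apply: (@le_integrable _ _ _ _ _ _ _ (EFin \o cst K%:R)) => //.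
  - exact/measurable_EFinP/measurable_trunc_sup.
  - move=> w _; rewrite lee_fin !ger0_norm ?trunc_sup_ge0//.
    by rewrite -lee_fin trunc_supE ge_min lexx orbT.
  - exact: finite_measure_integrable_cst.
have [|||||iH _ /=] := @dominated_convergence _ _ _ P setT measurableT
    (fun K w => (trunc_sup K 0 w - trunc_sup K 1 w)%:E) (fun w => (H w)%:E)
    (fun w => `|xi w|%:E).
- move=> K; apply/measurable_EFinP; apply: measurable_funB;
    exact: measurable_trunc_sup.
- exact/measurable_EFinP.
- apply: filterS aeF => w [r0 [r1 [S0 S1]]] _; apply: cvg_near_cst.
  exists (Num.truncn (Num.max r0 r1)).+1 => // K /= rK; congr _%:E.
  rewrite (trunc_sup_fin _ S0) (trunc_sup_fin _ S1) /H S0 S1/=.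
  have : Num.max r0 r1 < K%:R.
    by apply: lt_le_trans (truncnS_gt _) _; rewrite ler_nat.
  by rewrite gt_max => /andP[/ltW/min_l-> /ltW/min_l->].
- exact: integrable_norm.
(* By [stepE], [r0 - r1] is the maximum of [- r1 <= 0] and [xi w], hence at most [|xi w|] in
   absolute value; capping both terms at [K] cannot increase their distance. *)
- apply: filterS aeF => w [r0 [r1 [S0 S1]]] K _; rewrite lee_fin.
  rewrite (trunc_sup_fin _ S0) (trunc_sup_fin _ S1).
  have [r10 ->] := stepE _ _ _ S0 S1.
  have K0 : 0 <= K%:R :> R by [].
  rewrite ler_norml; have := ler_norm (xi w); have := ler_norm (- xi w).
  rewrite normrN; case: (leP (xi w + r1)) => h1; case: (leP _ K%:R) => h2;
    case: (leP r1) => h3; by move=> ? ?; apply/andP; split; lra.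
move=> cvH.
have H0 : (\int[P]_w (H w)%:E = 0)%E.
  rewrite -(cvg_lim _ cvH)//; apply/cvg_lim => //; apply: cvg_near_cst.
  apply: nearW => K; under eq_integral do rewrite EFinB.
  rewrite integralB_EFin; [|by []|exact: iT|exact: iT].
  by rewrite mean_trunc_sup subee// integrable_fin_num//; exact: iT.
pose D w := H w - xi w.
have D0 : {ae P, forall w, 0 <= D w}.
  apply: filterS aeF => w [r0 [r1 [S0 S1]]]; rewrite /D /H S0 S1/=.
  have [r10 ->] := stepE _ _ _ S0 S1.
  by case: (leP 0 (xi w + r1)); lra.
have mxi : measurable_fun setT xi by exact: measurable_funB.
have mD : measurable_fun setT D by exact: measurable_funB.
have ED : (\int[P]_w (D w)%:E = (c - \int[P]_w x 0 w)%:E)%E.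
  under eq_integral do rewrite EFinB.
  rewrite integralB_EFin; [|by []|exact: iH|exact: integrable_xBc].
  by rewrite H0 mean_xBc sub0e -EFinB -EFinN opprB.
have Deq0 : {ae P, forall w, D w = 0}.
  by apply: ae_eq0_integral_le0 => //; rewrite ED lee_fin subr_le0.
have xE : \int[P]_w x 0 w = c.
  apply/eqP; rewrite -subr_eq0 -oppr_eq0 opprB -eqe -ED; apply/eqP.
  rewrite (@ae_eq_integral _ _ _ _ _ (cst 0%E))//.
  - by rewrite integral_cst// mul0e.
  - exact/measurable_EFinP.
  - by apply: filterS Deq0 => w -> _.
pose G k := [set w | xi w <= - k.+1%:R^-1].
have mG k : measurable (G k).
  rewrite -[G k]setTI (_ : G k = xi @^-1` `]-oo, - k.+1%:R^-1]); last first.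
    by apply/seteqP; split => w /=; rewrite in_itv.
  exact: mxi.
(* As [xi] has mean zero and is positive with positive probability, it is also negative with
   positive probability, and then bounded away from 0 by some [k.+1%:R^-1]. *)
have [k Gk] : exists k, P (G k) <> 0%E.
  apply: contrapT => /forallNP hG; apply: xc0.
  have xi0 : {ae P, forall w, 0 <= xi w}.
    have /ae_foralln : forall k, {ae P, forall w, ~ G k w}.
      move=> k; exists (G k); split => //; last by move=> w /contrapT.
      exact: contrapT (hG k).
    apply: filterS => w nG; rewrite leNgt; apply/negP => xi_lt0.
    apply: (nG (Num.truncn (- xi w)^-1)); rewrite /G/= lerNr.
    have xi_gt0 : 0 < - xi w by rewrite oppr_gt0.
    rewrite -[leRHS]invrK lef_pV2 ?posrE ?invr_gt0//.
    exact/ltW/truncnS_gt.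
  have xieq0 : {ae P, forall w, xi w = 0}.
    by apply: ae_eq0_integral_le0 => //; rewrite mean_xBc xE -EFinB subrr.
  have [A [mA PA0 hA]] := xieq0.
  apply: (@subset_measure0 _ _ _ P _ A) => //.
    rewrite -[X in measurable X]setTI.
    rewrite (_ : [set w | _] = x 0 @^-1` `]c, +oo[); first exact: mx.
    by apply/seteqP; split => w /=; rewrite in_itv/= andbT.
  by move=> w /= cxw; apply: hA => /= /eqP; rewrite subr_eq0 => /eqP xw;
    move: cxw; rewrite xw ltxx.
pose e : R := k.+1%:R^-1.
have e0 : 0 < e by rewrite invr_gt0.
pose B N a := [set w | (S N w <= a%:E)%E].
have BC N a : B N a = ~` [set w | (a%:E < S N w)%E].
  by apply/seteqP; split => w; rewrite /B/= leNgt => /negP.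
have mlt N a : measurable [set w | (a%:E < S N w)%E].
  rewrite -[X in measurable X]setTI; apply: emeasurable_fun_o_infty => //.
  exact: measurable_lindley_sup.
have mB N a : measurable (B N a) by rewrite BC; exact: measurableC.
have GB a : independent_events P (G k) (B 1 a).
  rewrite BC; apply: independent_eventsC => //.
  have -> : [set w | (a%:E < S 1 w)%E] = \bigcup_n [set w | a < M n 1 w].
    apply/seteqP; split => w /=.
      by move=> /lt_lindley_sup[n]; rewrite lte_fin => kn; exists n.
    by move=> [n _ /= kn]; apply/lt_lindley_sup; exists n; rewrite lte_fin.
  apply: independent_events_bigcup => //.
  - by move=> n; exact: measurable_lt_lindley.
  - by move=> m n mn w /= /lt_le_trans; apply; exact: lindley_nd.
  move=> n; apply: independent_events_sym.
  have -> : G k = ~` [set w | c - e < x 0 w].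
    apply/seteqP; split => w; rewrite /G /xi -/e /= => h.
      by apply/negP; rewrite -leNgt; lra.
    by move/negP: h; rewrite -leNgt => h; lra.
  apply: independent_eventsC; first exact: measurable_lt_lindley.
    rewrite -[X in measurable X]setTI.
    rewrite (_ : [set w | _] = x 0 @^-1` `]c - e, +oo[); first exact: mx.
    by apply/seteqP; split => w /=; rewrite in_itv/= andbT.
  exact: independent_events_sym.
(* Induction in steps of [e], the offset making the case [j = 0] empty. On [G k] one has
   [S 0 w <= S 1 w - e], so a bound on [S 1 w] at rank [j.+1] gives the bound on [S 0 w] at rank
   [j], a null event because both suprema have the same law; independence then removes the
   restriction to [G k]. *)
have B0 j : P (B 1 (j%:R * e - e)) = 0%E.
  elim: j => [|j ih].
    rewrite (_ : B 1 _ = set0) ?measure0//; apply/seteqP; split => w //=.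
    rewrite /B/= leNgt => /negP; apply.
    by apply: lt_le_trans (lindley_sup_ge0 _ _ _); rewrite lte_fin; lra.
  have BG0 : P (G k `&` B 1 (j.+1%:R * e - e)) = 0%E.
    have [A [mA PA0 hA]] := filterI Deq0 aeF.
    have PB0 : P (B 0 (j%:R * e - e)) = 0%E.
      by rewrite BC probability_setC// -lindley_sup_law -probability_setC// -BC.
    apply: (@subset_measure0 _ _ _ P _ (A `|` B 0 (j%:R * e - e))) => //.
    - exact: measurableI.
    - exact: measurableU.
    - move=> w [Gw Bw]; have [[Dw [r0 [r1 [S0 S1]]]]|] := pselect
        (D w = 0 /\ exists r0 r1, S 0 w = r0%:E /\ S 1 w = r1%:E); last first.
        by move=> h; left; apply: hA.
      right; move: Bw Gw Dw; rewrite /B /G /D /H /= S0 S1 /= !lee_fin -/e.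
      by rewrite -natr1 mulrDl mul1r; lra.
    - by apply: etrans PA0; exact: measureU0.
  move: BG0; rewrite GB => /eqP; rewrite mule_eq0 => /orP[/eqP//|/eqP//].
have /ae_foralln : forall j, {ae P, forall w, ~ B 1 (j%:R * e - e) w}.
  by move=> j; exists (B 1 (j%:R * e - e)); split => // w /contrapT.
move=> /(filterI aeF)[A [mA PA0 hA]].
have : P setT = 0%E.
  apply: (@subset_measure0 _ _ _ P _ A) => // w _;
    apply: hA => -[[r0 [r1 [S0 S1]]]] nB.
  apply: (nB (Num.truncn ((r1 + e) / e)).+1); rewrite /B/= S1 lee_fin lerBrDr.
  by rewrite -ler_pdivrMr//; exact/ltW/truncnS_gt.
by rewrite probability_setT => /eqP; rewrite onee_eq0.
Qed.

End walk.

(** * Discretized arrivals in unit windows *)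

Section countable_valued.
Context {d : measure_display} {Omega : measurableType d} {R : realType}.
Variable P : probability Omega R.
Context {T : countType}.
Implicit Types (W : Omega -> T) (G : set T) (E : set Omega).

(** Each [pickle] code selects at most one element, so that sums over the countable type become
    series over [nat]. *)
Let slice G (k : nat) := G `&` [set u | pickle u = k].

Let sliceP G k : slice G k = set0 \/ exists u, slice G k = [set u].
Proof.
have [[u [Gu uk]]|h] := pselect (slice G k !=set0).
  right; exists u; apply/seteqP; split => [v [_ vk]|_ ->//].
  by apply: (pcan_inj pickleK); rewrite vk uk.
by left; apply: contrapT => /eqP/set0P.
Qed.

Let bigcup_slice G : G = \bigcup_k slice G k.
Proof. by apply/seteqP; split => [u Gu|u [k _ []]//]; exists (pickle u). Qed.

Let measurable_slice W G k : (forall u, measurable (W @^-1` [set u])) ->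
  measurable (W @^-1` slice G k).
Proof.
by move=> mW; have [->|[u ->]//] := sliceP G k; rewrite preimage_set0.
Qed.

Lemma measurable_preimage_countable W G :
  (forall u, measurable (W @^-1` [set u])) -> measurable (W @^-1` G).
Proof.
move=> mW; rewrite (bigcup_slice G) preimage_bigcup.
by apply: bigcup_measurable => k _; exact: measurable_slice.
Qed.

Let slice_sum W G E : (forall u, measurable (W @^-1` [set u])) ->
  measurable E ->
  P (E `&` W @^-1` G) = (\sum_(0 <= k <oo) P (E `&` W @^-1` slice G k))%E.
Proof.
move=> mW mE; rewrite {1}(bigcup_slice G) preimage_bigcup setI_bigcupr.
rewrite measure_bigcup//=; last 2 first.
- by move=> k _; apply: measurableI => //; exact: measurable_slice.
- move=> i j _ _ [w [[_ [_ wi]] [_ [_ wj]]]].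
  by rewrite -wi -wj.
by apply: eq_eseriesl => k; rewrite mem_setT.
Qed.

Lemma independent_events_countable W G E :
  (forall u, measurable (W @^-1` [set u])) -> measurable E ->
  (forall u, independent_events P E (W @^-1` [set u])) ->
  independent_events P E (W @^-1` G).
Proof.
move=> mW mE EW; rewrite /independent_events slice_sum//.
have fE : P E = (fine (P E))%:E by rewrite fineK// fin_num_measure.
rewrite -[in RHS](setTI (W @^-1` G)) slice_sum// fE -nneseriesZl//.
apply: eq_eseriesr => k _; rewrite -fE setTI.
have [->|[u ->]] := sliceP G k; last exact: EW.
by rewrite preimage_set0 setI0 measure0 mule0.
Qed.

Lemma eq_law_countable W W' G :
  (forall u, measurable (W @^-1` [set u])) ->
  (forall u, measurable (W' @^-1` [set u])) ->
  (forall u, P (W @^-1` [set u]) = P (W' @^-1` [set u])) ->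
  P (W @^-1` G) = P (W' @^-1` G).
Proof.
move=> mW mW' WW'; rewrite -(setTI (W @^-1` G)) -(setTI (W' @^-1` G)).
rewrite !slice_sum//; apply: eq_eseriesr => k _; rewrite !setTI.
by have [->|[u ->]//] := sliceP G k; rewrite !preimage_set0.
Qed.

Variable U : nat -> Omega -> T.
Hypothesis mU : forall j u, measurable (U j @^-1` [set u]).

Definition block (N n : nat) (w : Omega) : {ffun 'I_n -> T} :=
  [ffun j : 'I_n => U (N + j)%N w].

Lemma block_preimage N n (v : {ffun 'I_n -> T}) :
  block N n @^-1` [set v] =
  \bigcap_(j in [set: 'I_n]) U (N + j)%N @^-1` [set v j].
Proof.
apply/seteqP; split => w /=.
  by move=> <- j _; rewrite /block /= ffunE.
by move=> h; apply/ffunP => j; rewrite ffunE h.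
Qed.

Lemma measurable_block N n (v : {ffun 'I_n -> T}) :
  measurable (block N n @^-1` [set v]).
Proof.
rewrite block_preimage; apply: fin_bigcap_measurable => //.
Qed.

End countable_valued.

Section iid_blocks.
Context {d : measure_display} {Omega : measurableType d} {R : realType}.
Variable P : probability Omega R.
Context {T : countType} (U : nat -> Omega -> T) (p : T -> \bar R).
Hypothesis mU : forall j u, measurable (U j @^-1` [set u]).
Hypothesis block_law : forall N n (v : {ffun 'I_n -> T}),
  P (block U N n @^-1` [set v]) = (\prod_(j < n) p (v j))%E.

Lemma block_stationary N n (G : set {ffun 'I_n -> T}) :
  P (block U N n @^-1` G) = P (block U 0 n @^-1` G).
Proof.
apply: eq_law_countable.
- by move=> v; exact: measurable_block.
- by move=> v; exact: measurable_block.
- by move=> v; rewrite !block_law.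
Qed.

(** It suffices to treat single values [u] and [v]. Their joint event says that the block of length
    [N + n] equals the concatenation [uv], and the product formula of [block_law] splits at [N]. *)
Lemma block_independent N n (G : set {ffun 'I_N -> T})
    (H : set {ffun 'I_n -> T}) :
  independent_events P (block U 0 N @^-1` G) (block U N n @^-1` H).
Proof.
have mB M k (v : {ffun 'I_k -> T}) : measurable (block U M k @^-1` [set v]).
  exact: measurable_block.
suff key u v :
    independent_events P (block U 0 N @^-1` [set u]) (block U N n @^-1` [set
      v]).
  apply: independent_events_countable => [v||v]; first exact: mB.
    by apply: measurable_preimage_countable => u; exact: mB.
  apply: independent_events_sym.
  apply: independent_events_countable => [u||u]; [exact: mB|exact: mB|].
  by apply: independent_events_sym; exact: key.
rewrite /independent_events !block_law.
pose uv : {ffun 'I_(N + n) -> T} :=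
  [ffun k : 'I_(N + n) => match fintype.split k with inl i => u i | inr j => v
    j end].
transitivity (P (block U 0 (N + n) @^-1` [set uv])).
  congr (P _); rewrite !block_preimage; apply/seteqP; split => w /=.
    move=> [hu hv] k _; rewrite /= ffunE; case: fintype.splitP => j kj.
      by have := hu j I; rewrite /= !add0n kj.
    by have := hv j I; rewrite /= !add0n kj.
  move=> h; split => j _ /=.
    have := h (lshift n j) I; rewrite /= ffunE !add0n.
    by case: fintype.splitP => //= i; [move=> /val_inj ->|move=> ji;
      have := ltn_ord j; rewrite ji ltnNge leq_addr].
  have := h (rshift N j) I; rewrite /= ffunE add0n.
  by case: fintype.splitP => //= i; [move=> ji; have := ltn_ord i;
    rewrite -ji ltnNge leq_addr|move=> /addnI /val_inj ->].
rewrite block_law big_split_ord/=; congr (_ * _)%E; apply: eq_bigr => j _;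
  rewrite ffunE; case: fintype.splitP => //= i.
- by move=> /val_inj ->.
- by move=> ji; have := ltn_ord j; rewrite ji ltnNge leq_addr.
- by move=> ji; have := ltn_ord i; rewrite -ji ltnNge leq_addr.
- by move=> /addnI /val_inj ->.
Qed.

End iid_blocks.

(** * Poisson weights and counts *)

Section poisson_series.
Context {R : realType}.
Implicit Types r : R.

Definition poisson_weight r (k : nat) : R := expR (- r) * r ^+ k / k`!%:R.

Lemma poisson_weight_ge0 r k : 0 <= r -> 0 <= poisson_weight r k.
Proof.
by move=> r0; rewrite /poisson_weight !mulr_ge0 ?expR_ge0 ?exprn_ge0.
Qed.

Lemma poisson_weight_sum r : 0 <= r ->
  (\sum_(0 <= k <oo) (poisson_weight r k)%:E = 1)%E.
Proof.
move=> r0.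
have -> : (\sum_(0 <= k <oo) (poisson_weight r k)%:E =
    (expR (- r))%:E * \sum_(0 <= k <oo) (exp_coeff r k)%:E)%E.
  rewrite -nneseriesZl; last by move=> k _; rewrite lee_fin exp_coeff_ge0.
  by apply: eq_eseriesr => k _; rewrite -EFinM /poisson_weight -mulrA.
rewrite (_ : (\sum_(0 <= k <oo) _)%E = (expR r)%:E).
  by rewrite -EFinM -expRD addNr expR0.
rewrite /expR -EFin_lim; last exact: is_cvg_series_exp_coeff.
by apply/congr_lim/funext => n /=; rewrite /series/= -sumEFin.
Qed.

(** [k] times the weight of [k] is [r] times the preceding weight, so the series shifts to [r] times
    the total mass. *)
Lemma poisson_weight_mean r : 0 <= r ->
  (\sum_(0 <= k <oo) (k%:R * poisson_weight r k)%:E = r%:E)%E.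
Proof.
move=> r0; rewrite nneseries_recl//; last first.
  by move=> k _; rewrite lee_fin mulr_ge0 ?poisson_weight_ge0.
rewrite mul0r add0e -[LHS]/(limn _).
have -> : (\sum_(1 <= k <oo) (k%:R * poisson_weight r k)%:E =
    \sum_(0 <= k <oo) (r%:E * (poisson_weight r k)%:E))%E.
  rewrite -nneseries_addn; last first.
    by move=> k; rewrite lee_fin mulr_ge0 ?poisson_weight_ge0.
  apply: eq_eseriesr => k _; rewrite -EFinM addn1; congr _%:E.
  rewrite /poisson_weight factS natrM exprS.
  have : k.+1%:R != 0 :> R by rewrite pnatr_eq0.
  have : k`!%:R != 0 :> R by rewrite pnatr_eq0 -lt0n fact_gt0.
  by move: k.+1%:R k`!%:R => a b a0 b0; field; rewrite a0 b0.
rewrite nneseriesZl ?poisson_weight_sum ?mule1// => k _.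
by rewrite lee_fin poisson_weight_ge0.
Qed.

End poisson_series.

Section poisson_counts.
Context {R : realType} {d d' : measure_display}.
Context {Omega : measurableType d} {T : measurableType d'}.
Variables (P : probability Omega R) (mu : set T -> \bar R).
Variable p : nat -> Omega -> T.
Hypothesis ppp : is_poisson_point_process P mu p.

Local Notation count := (point_count (R := R) p).

Definition point_num (A : set T) (w : Omega) : nat :=
  Num.truncn (fine (count A w)).

Lemma point_count_cases A w :
  count A w = +oo%E \/ count A w = (point_num A w)%:R%:E.
Proof.
rewrite /point_num /point_count /counting; case: ifPn => _; last by left.
by right; rewrite /= natrK.
Qed.

Lemma point_count_series A w :
  count A w = (\sum_(0 <= i <oo) (\1_A (p i w))%:E)%E.
Proof. by rewrite /point_count counting_dirac. Qed.

Lemma measurable_point_count A : measurable A ->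
  measurable_fun setT (count A).
Proof.
move=> mA; apply: (eq_measurable_fun
  (fun w => (\sum_(0 <= i <oo) (\1_A (p i w))%:E)%E)).
  by move=> w _; rewrite point_count_series.
apply: ge0_emeasurable_sum => // i _.
apply/measurable_EFinP; apply: measurableT_comp.
  exact: measurable_indic.
exact: ppp_measurable ppp i.
Qed.

(** The counts that [point_num] sends to [k]; [+oo] joins the value 0 because [fine] sends it
    there. *)
Let level (k : nat) : set (\bar R) :=
  [set k%:R%:E] `|` (if k == 0%N then [set +oo%E] else set0).

Let measurable_level k : measurable (level k).
Proof. by apply: measurableU; [exact: emeasurable_set1|case: ifP]. Qed.

Let point_num_preimage A k : point_num A @^-1` [set k] = count A @^-1` level k.
Proof.
apply/seteqP; split => w; rewrite /level /=.
  move=> <-; have [cy|->] := point_count_cases A w; last by left.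
  by right; rewrite /point_num cy/= truncn0.
move=> [ck|]; first by rewrite /point_num ck/= natrK.
by case: ifPn => // /eqP -> /= cy; rewrite /point_num cy/= truncn0.
Qed.

Lemma measurable_point_num A k : measurable A ->
  measurable (point_num A @^-1` [set k]).
Proof.
move=> mA; rewrite point_num_preimage -[X in measurable X]setTI.
exact: measurable_point_count.
Qed.

Let measurable_count_eq A (e : \bar R) : measurable A ->
  measurable (count A @^-1` [set e]).
Proof.
move=> mA; rewrite -[X in measurable X]setTI.
exact: measurable_point_count.
Qed.

(** The Poisson weights of the finite counts already add up to 1. *)
Lemma point_count_ae_fin A r : measurable A -> 0 <= r -> mu A = r%:E ->
  P (count A @^-1` [set +oo%E]) = 0%E.
Proof.
move=> mA r0 muA.
pose F k := count A @^-1` [set k%:R%:E : \bar R].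
have mF k : measurable (F k) by exact: measurable_count_eq.
have PF : P (\bigcup_k F k) = 1%E.
  rewrite measure_bigcup//=; last first.
    move=> i j _ _ [w [Fi Fj]]; move: Fi; rewrite /F/= Fj => -[] /eqP.
    by rewrite eqr_nat => /eqP.
  rewrite -(poisson_weight_sum r0).
  transitivity (\sum_(0 <= k <oo) P (F k))%E.
    by apply: eq_eseriesl => k; rewrite mem_setT.
  by apply: eq_eseriesr => k _; rewrite (ppp_finite ppp mA muA).
have -> : count A @^-1` [set +oo%E] = ~` \bigcup_k F k.
  apply/seteqP; split => w /=.
    by move=> cy [k _]; rewrite /F/= cy.
  move=> h; have [//|ck] := point_count_cases A w.
  by exfalso; apply: h; exists (point_num A w).
rewrite probability_setC; last exact: bigcup_measurable.
by rewrite PF subee.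
Qed.

Lemma point_count_ae A r : measurable A -> 0 <= r -> mu A = r%:E ->
  {ae P, forall w, count A w = (point_num A w)%:R%:E}.
Proof.
move=> mA r0 muA; exists (count A @^-1` [set +oo%E]); split.
- exact: measurable_count_eq.
- exact: point_count_ae_fin r0 muA.
- by move=> w /= h; have [|] := point_count_cases A w.
Qed.

Lemma point_num_law A r k : measurable A -> 0 <= r -> mu A = r%:E ->
  P (point_num A @^-1` [set k]) = (poisson_weight r k)%:E.
Proof.
move=> mA r0 muA; rewrite /poisson_weight -(ppp_finite ppp mA muA).
apply: ae_iff_measure.
- exact: measurable_point_num.
- exact: measurable_count_eq.
- apply: filterS (point_count_ae mA r0 muA) => w /= ->.
  split=> [->//|[]/eqP]; by rewrite eqr_nat => /eqP.
Qed.

(** Stated over any finite index type, since it is applied to pairs of a window and a level. *)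
Lemma point_num_indep (J : finType) (A : J -> set T) (r : J -> R)
    (k : J -> nat) : (forall i, measurable (A i)) -> trivIset setT A ->
  (forall i, 0 <= r i) -> (forall i, mu (A i) = (r i)%:E) ->
  P (\bigcap_(i in [set: J]) point_num (A i) @^-1` [set k i]) =
  (\prod_(i : J) (poisson_weight (r i) (k i))%:E)%E.
Proof.
move=> mA tA r0 muA.
pose A' (j : 'I_#|J|) := A (enum_val j).
have tA' : trivIset setT A'.
  by move=> i j _ _ h; apply: enum_val_inj; exact: tA.
have := ppp_independent ppp (fun j => mA (enum_val j)) tA'.
move=> /(_ (fun j => level (k (enum_val j))) (fun j => measurable_level _)).
rewrite [X in P X = _ -> _](_ : _ = \bigcap_(i in [set: J])
    point_num (A i) @^-1` [set k i]); last first.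
  apply/seteqP; split => w h.
    move=> i _; rewrite point_num_preimage; have := h (enum_rank i) I.
    by rewrite /A'/= enum_rankK.
  move=> j _; have := h (enum_val j) I.
  by rewrite /= -[point_num _ w = _]/((point_num _ @^-1` [set _]) w)
    point_num_preimage.
move=> ->; rewrite (reindex (@enum_val J predT))/=; last first.
  by exists enum_rank => i _; [exact: enum_valK|exact: enum_rankK].
apply: eq_bigr => j _; rewrite -(point_num_law _ (mA _) (r0 _) (muA _)).
by rewrite point_num_preimage.
Qed.

Lemma point_count_mean A r : measurable A -> 0 <= r -> mu A = r%:E ->
  (\int[P]_w count A w = r%:E)%E.
Proof.
move=> mA r0 muA.
pose f k w : \bar R := (k%:R * \1_(point_num A @^-1` [set k]) w)%:E.
have mf k : measurable_fun setT (f k).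
  apply/measurable_EFinP; apply: measurable_funM => //.
  by apply: measurable_indic; exact: measurable_point_num.
have f0 k w : (0 <= f k w)%E by rewrite lee_fin mulr_ge0.
have -> : (\int[P]_w count A w = \int[P]_w (\sum_(0 <= k <oo) f k w))%E.
  apply: ae_eq_integral => //.
  - exact: measurable_point_count.
  - exact: ge0_emeasurable_sum.
  - apply: filterS (point_count_ae mA r0 muA) => w -> _.
    set n := point_num A w.
    rewrite nneseries_esumT// (esumID [set n])//= !setTI esum_set1//.
    rewrite /f indicE mem_set// mulr1 esum1 ?adde0// => k /= kn.
    by rewrite indicE memNset ?mulr0// => /= nk; apply: kn.
rewrite integral_nneseries// -(poisson_weight_mean r0).
apply: eq_eseriesr => k _; rewrite /f; under eq_integral do rewrite EFinM.
rewrite ge0_integralZl_EFin//; last first.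
  by apply/measurable_EFinP/measurable_indic; exact: measurable_point_num.
rewrite integral_indic//; last exact: measurable_point_num.
rewrite setIT EFinM; congr (_ * _)%E; exact: point_num_law r0 muA.
Qed.

End poisson_counts.

(** * Intensity of boxes and rounding of sizes *)

Section file_boxes.
Context {R : realType}.
Variable nu : {measure set R -> \bar R}.
Local Notation leb := (@lebesgue_measure R).
Implicit Types (t a b : R) (L : set R).

(* Only arrival times t_i >= 0 carry intensity, so the box may be left
   unbounded below in the time coordinate. *)
Definition file_box t a b L : set (R * R * R) :=
  (`]-oo, t]%classic `*` `]a, b]%classic) `*` L.

Lemma measurable_file_box t a b L : measurable L ->
  measurable (file_box t a b L).
Proof. by move=> mL; apply: measurableX => //; exact: measurableX. Qed.

(** As [nu] is only a measure here, the outer product is evaluated as an integral of sections: the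
    section over a point is [L] inside [D] and empty outside. *)
Lemma file_intensity_box t a b L : 0 <= t -> a <= b -> measurable L ->
  file_intensity nu (file_box t a b L) = ((t * (b - a))%:E * nu L)%E.
Proof.
move=> t0 ab mL; pose D : set (R * R) := `[0, t]%classic `*` `]a, b]%classic.
have -> : file_intensity nu (file_box t a b L) =
    ((leb \x leb) \x nu)%E (D `*` L).
  rewrite /file_intensity; congr (_ _).
  apply/seteqP; split => -[[s y] l]; rewrite /file_box /D /= !in_itv/=.
    by move=> [[[-> ->] Ll] ->].
  by move=> [[/andP[-> ->] ->] Ll].
have mD : measurable D by exact: measurableX.
have leb_itv (x y : R) (u v : bool) : x <= y ->
    leb [set` Interval (BSide u x) (BSide v y)] = (y - x)%:E.
  move=> xy; rewrite lebesgue_measure_itv/= lte_fin.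
  by case: ltgtP xy => // -> _; rewrite subrr.
pose RT := g_sigma_algebraType (R.-ocitv.-measurable).
pose leb2 : {measure set (RT * RT) -> \bar R} := (leb \x leb)%E.
transitivity (\int[leb2]_z (nu L * (\1_D z)%:E))%E.
  apply: eq_integral => z _; rewrite /= indicE; case: (boolP (z \in D)) => zD.
    by rewrite in_xsectionX// mule1.
  by rewrite notin_xsectionX// measure0 mule0.
rewrite ge0_integralZl//; last first.
  by apply/measurable_EFinP; exact: measurable_indic.
rewrite integral_indic// setIT muleC; congr (_ * _)%E.
transitivity (leb `[0%R, t]%classic * leb `]a, b]%classic)%E;
  first exact: product_measure1E.
by rewrite !leb_itv// subr0 -EFinM.
Qed.

End file_boxes.

Section size_levels.
Import HBNNSimple.
Context {R : realType}.
Implicit Types (l : R).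

Record level := Level { level_num : nat; level_val : 'I_level_num -> R;
  level_set : 'I_level_num -> set R }.

Definition level_fun (s : level) l : R :=
  \sum_(i < level_num s) level_val i * \1_(level_set (l := s) i) l.

(* The level functions are simple functions increasing to the identity of
   (0, +oo); zero is not among the levels, as its level set may have infinite
   mass. *)
Record size_levels (nu : set R -> \bar R) (s : nat -> level) : Prop := {
  size_levels_ge0 : forall r (i : 'I_(level_num (s r))), 0 <= level_val i ;
  size_levels_measurable : forall r (i : 'I_(level_num (s r))),
    measurable (level_set i) ;
  size_levels_pos : forall r (i : 'I_(level_num (s r))),
    level_set i `<=` `]0, +oo[ ;
  size_levels_disjoint : forall r,
    trivIset setT (level_set (l := s r)) ;
  size_levels_fin : forall r (i : 'I_(level_num (s r))),
    (nu (level_set i) < +oo)%E ;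
  size_levels_nd : forall l, 0 < l ->
    nondecreasing_seq (fun r => level_fun (s r) l) ;
  size_levels_cvg : forall l, 0 < l -> level_fun (s r) l @[r --> \oo] --> l }.

(** The levels are the positive values of the standard simple approximations of the identity on the
    positive half-line. A level [v > 0] has finite mass by Markov's inequality: [v] times its mass
    is at most the mean size. *)
Lemma size_levels_exist (nu : {measure set R -> \bar R}) :
  (mean_size nu < +oo)%E -> exists s, size_levels nu s.
Proof.
move=> nufin; pose D : set R := `]0, +oo[%classic.
have mD : measurable D by exact: measurable_itv.
have mE : measurable_fun D (EFin : R -> \bar R).
  exact/measurable_EFinP/measurable_id.
have E0 l : D l -> (0 <= l%:E :> \bar R)%E.
  by rewrite /D/= in_itv/= andbT lee_fin => /ltW.
pose f r := nnsfun_approx mD mE r.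
pose vals r : seq R := [seq v <- finmap.enum_fset (fset_set (range (f r))) | 0
  < v].
pose s r := @Level (size (vals r)) (fun i => nth 0 (vals r) i)
  (fun i => D `&` f r @^-1` [set nth 0 (vals r) i]).
have vals_pos r i : (i < size (vals r))%N -> 0 < nth 0 (vals r) i.
  by move=> ir; have := mem_nth 0 ir; rewrite mem_filter => /andP[].
have vals_uniq r : uniq (vals r) by rewrite filter_uniq// finmap.fset_uniq.
have sE r l : 0 < l -> level_fun (s r) l = f r l.
  move=> l0; rewrite /level_fun /=.
  have Dl : D l by rewrite /D/= in_itv/= l0.
  transitivity (\sum_(v <- vals r) v * (v == f r l)%:R).
    rewrite (big_nth 0) big_mkord; apply: eq_bigr => i _; congr (_ * _).
    rewrite indicE; congr (nat_of_bool _)%:R; apply/idP/idP.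
      by rewrite inE => -[_ /= ->].
    by move=> /eqP ->; rewrite inE.
  have [fl|fl] := boolP (f r l \in vals r).
    rewrite (bigD1_seq (f r l))//= eqxx mulr1 big1 ?addr0// => v /negbTE ->.
    by rewrite mulr0.
  rewrite big1_seq; last first.
    move=> v /= vv; case: eqP => [vf|_]; last by rewrite mulr0.
    by move: fl; rewrite -vf vv.
  (* A value of [f r] missing from [vals r] is not positive, hence 0, in agreement with the
     vanishing sum. *)
  move: fl; rewrite mem_filter negb_and => /orP[|].
    by rewrite -leNgt => f0; apply/eqP; rewrite eq_le f0 fun_ge0.
  rewrite in_fset_set; last exact: fimfunP.
  by rewrite notin_setE => h; exfalso; apply: h; exists l.
have f_cvg l : 0 < l -> f r l @[r --> \oo] --> l.
  move=> l0; have Dl : D l by rewrite /D/= in_itv/= l0.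
  by have := cvg_nnsfun_approx mD mE E0 Dl => /fine_cvg.
have f_nd l : nondecreasing_seq (fun r => f r l).
  by move=> m n mn; have /lefP := nd_nnsfun_approx mD mE mn; exact.
have f_le r l : 0 < l -> f r l <= l.
  move=> l0; rewrite -[leRHS](cvg_lim _ (f_cvg l l0))//.
  apply: nondecreasing_cvgn_le => //.
  by apply/cvg_ex; exists l; exact: f_cvg.
exists s; split.
- by move=> r i; apply: ltW; exact: vals_pos.
- by move=> r i; apply: measurableI => //.
- by move=> r i l [].
- move=> r i j _ _ [l [[_ /= li] [_ /= lj]]]; apply/val_inj/eqP.
  by rewrite -(nth_uniq 0 (ltn_ord i) (ltn_ord j) (vals_uniq r));
    apply/eqP/(etrans (esym li)).
- move=> r i; set L := level_set i.
  have mL : measurable L by exact: measurableI.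
  have v0 := vals_pos r i (ltn_ord i).
  have : ((nth 0 (vals r) i)%:E * nu L < +oo)%E.
    rewrite -(integral_cst nu mL); apply: le_lt_trans nufin.
    apply: (@le_trans _ _ (\int[nu]_(l in L) l%:E)%E).
      apply: ge0_le_integral => //.
      - by move=> l _; rewrite /= lee_fin ltW.
      - by move=> l [Dl /= <-]; rewrite lee_fin f_le//; move: Dl;
        rewrite /D/= in_itv/= andbT.
    by apply: ge0_subset_integral => // l [].
  by rewrite -lte_pdivlMl// => /lt_le_trans; apply; rewrite leey.
- by move=> l l0 m n mn; rewrite !sE//; exact: f_nd.
- by move=> l l0; under eq_fun do rewrite sE//; exact: f_cvg.
Qed.

Lemma level_fun_ge0 nu s r l : size_levels nu s -> 0 <= level_fun (s r) l.
Proof. by move=> sP; apply: sumr_ge0 => i _;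
  rewrite mulr_ge0// (size_levels_ge0 sP). Qed.

Lemma measurable_level_fun nu s r : size_levels nu s ->
  measurable_fun setT (level_fun (s r)).
Proof.
move=> sP; apply: measurable_sum => i; apply: measurable_funM => //.
by apply: measurable_indic; exact: size_levels_measurable sP _ _.
Qed.

Lemma level_fun_integral (nu : {measure set R -> \bar R}) s r :
  size_levels nu s ->
  (\int[nu]_(l in `]0%R, +oo[) (level_fun (s r) l)%:E =
   \sum_(i < level_num (s r)) (level_val i)%:E * nu (level_set (l := s r) i))%E.
Proof.
move=> sP; rewrite /level_fun.
under eq_integral do rewrite -sumEFin.
rewrite ge0_integral_sum//; last 2 first.
- move=> i; apply/measurable_EFinP; apply: measurable_funM => //.
  by apply: measurable_indic; exact: size_levels_measurable sP _ _.
- by move=> i l _; rewrite lee_fin mulr_ge0// (size_levels_ge0 sP).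
apply: eq_bigr => i _; under eq_integral do rewrite EFinM.
have mL := size_levels_measurable sP i.
rewrite ge0_integralZl_EFin//; last 2 first.
- by apply/measurable_EFinP; exact: measurable_indic.
- exact: size_levels_ge0 sP _ _.
rewrite integral_indic//; congr (_ * nu _)%E; apply: setIidl.
exact: size_levels_pos sP _ _.
Qed.

Lemma level_fun_integral_cvg (nu : {measure set R -> \bar R}) s :
  size_levels nu s ->
  (\int[nu]_(l in `]0%R, +oo[) (level_fun (s r) l)%:E)%E @[r --> \oo] -->
  mean_size nu.
Proof.
move=> sP; rewrite /mean_size.
rewrite [X in _ --> X](_ : _ = \int[nu]_(l in `]0%R, +oo[)
    limn (fun r => (level_fun (s r) l)%:E))%E; last first.
  apply: eq_integral => l; rewrite inE/= in_itv/= andbT => l0.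
  by apply/esym/cvg_lim => //; apply: cvg_EFin;
    [exact: nearW|exact: size_levels_cvg sP _ l0].
apply: cvg_monotone_convergence => //.
- move=> r; apply/measurable_EFinP; apply: measurable_funTS.
  exact: measurable_level_fun sP.
- by move=> r l _; rewrite lee_fin; exact: level_fun_ge0 sP.
- move=> l /=; rewrite in_itv/= andbT => l0 m n mn; rewrite lee_fin.
  exact: size_levels_nd sP _ l0 _ _ mn.
Qed.

End size_levels.

(** * Total size arriving in an interval *)

Section arrivals.
Context {R : realType} {d : measure_display} {Omega : measurableType d}.
Variables (P : probability Omega R) (nu : {measure set R -> \bar R}).
Variables (ts xs ls : nat -> Omega -> R) (t : R) (s : nat -> @level R).
Hypothesis ls_gt0 : forall i w, 0 < ls i w.
Hypothesis t_ge0 : 0 <= t.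
Hypothesis mean_fin : (mean_size nu < +oo)%E.
Hypothesis sP : size_levels nu s.

Local Notation file := (fun i w => (ts i w, xs i w, ls i w)).
Hypothesis ppp : is_poisson_point_process P (file_intensity nu) file.

Local Notation arrived a b w :=
  (arrived_size (ts ^~ w) (xs ^~ w) (ls ^~ w) t a b).
Implicit Types a b : R.

Definition level_box r a b (i : 'I_(level_num (s r))) : set (R * R * R) :=
  file_box t a b (level_set i).

Definition level_rate r a b (i : 'I_(level_num (s r))) : R :=
  t * (b - a) * fine (nu (level_set i)).

Let measurable_level_box r a b i : measurable (@level_box r a b i).
Proof. by apply: measurable_file_box; exact: size_levels_measurable sP _ _. Qed.

Let level_rate_ge0 r a b i : a <= b -> 0 <= @level_rate r a b i.
Proof.
move=> ab; apply: mulr_ge0; last exact: fine_ge0.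
by apply: mulr_ge0 => //; rewrite subr_ge0.
Qed.

Let level_intensity r a b i : a <= b ->
  file_intensity nu (@level_box r a b i) = (level_rate a b i)%:E.
Proof.
move=> ab; rewrite /level_box file_intensity_box//; last first.
  exact: size_levels_measurable sP _ _.
rewrite /level_rate [in RHS]EFinM fineK// ge0_fin_numE//.
exact: size_levels_fin sP _ _.
Qed.

(** The rounded total size comes in two versions: this one converges to the true size at every [w],
    while [arrived_num] is a function of integers with known joint law. By [arrived_num_ae] they
    agree almost surely. *)
Definition arrived_count r a b w : \bar R :=
  (\sum_(i < level_num (s r))
     (level_val i)%:E * point_count (R := R) file (level_box a b i) w)%E.

Definition arrived_num r a b w : R :=
  \sum_(i < level_num (s r))
     level_val i * (point_num (R := R) file (level_box a b i) w)%:R.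

Let cond a b w k := (ts k w <= t) && (a < xs k w <= b).

Lemma arrived_countE r a b w : arrived_count r a b w =
  (\sum_(0 <= k <oo | cond a b w k) (level_fun (s r) (ls k w))%:E)%E.
Proof.
rewrite eseries_mkcond /arrived_count.
transitivity (\sum_(i < level_num (s r)) \sum_(0 <= k <oo)
    ((level_val i)%:E * (\1_(level_box a b i) (file k w))%:E))%E.
  apply: eq_bigr => i _; rewrite point_count_series nneseriesZl//.
rewrite -nneseries_sum; last first.
  by move=> i k _; rewrite mule_ge0// lee_fin// (size_levels_ge0 sP).
apply: eq_eseriesr => k _; rewrite /level_fun -sumEFin.
case: ifPn => [/andP[tk /andP[ak bk]]|nk].
  apply: eq_bigr => i _; rewrite -EFinM !indicE; congr (_ * _%:R)%:E.
  congr nat_of_bool; apply/idP/idP; rewrite !inE /level_box /file_box/=.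
    by case.
  by move=> h; split => //; split; rewrite /= in_itv/= ?ak.
rewrite big1// => i _; rewrite indicE memNset ?mule0//.
rewrite /level_box /file_box/= !in_itv/= => -[[tk xk] _].
by move/negP : nk; apply; rewrite /cond tk xk.
Qed.

Lemma arrived_count_nd a b w : nondecreasing_seq (fun r => arrived_count r a b
  w).
Proof.
move=> m n mn; rewrite !arrived_countE; apply: lee_nneseries => [k _ _|k _].
  by rewrite lee_fin; exact: level_fun_ge0 sP.
by rewrite lee_fin; apply: (size_levels_nd sP (ls_gt0 k w)).
Qed.

(** Monotone convergence for the counting measure on the labels. *)
Lemma arrived_count_cvg a b w :
  arrived_count r a b w @[r --> \oo] --> arrived a b w.
Proof.
pose h r k : \bar R := if cond a b w k then (level_fun (s r) (ls k w))%:E else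
  0%E.
have h0 r k : (0 <= h r k)%E.
  by rewrite /h; case: ifP => // _; rewrite lee_fin; exact: level_fun_ge0 sP.
have -> : (fun r => arrived_count r a b w) =
    (fun r => \int[counting]_k h r k)%E.
  by apply/funext => r; rewrite arrived_countE ge0_integral_count//
    eseries_mkcond.
have -> : arrived a b w =
    (\int[counting]_k limn (fun r => h r k))%E.
  have hl k : limn (fun r => h r k) = if cond a b w k then (ls k w)%:E else 0%E.
    rewrite /h; case: ifP => _; last exact: lim_cst.
    apply/cvg_lim => //; apply: cvg_EFin; first exact: nearW.
    exact: size_levels_cvg sP _ (ls_gt0 k w).
  under eq_integral do rewrite hl.
  rewrite ge0_integral_count; last first.
    by move=> k; case: ifP => // _; rewrite lee_fin ltW.
  by rewrite arrived_size_series// eseries_mkcond.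
apply: cvg_monotone_convergence => //.
move=> k _ m n mn; rewrite /h; case: ifP => // _.
by rewrite lee_fin; exact: (size_levels_nd sP (ls_gt0 k w) mn).
Qed.

Lemma measurable_arrived_count r a b : measurable_fun setT (arrived_count r a
  b).
Proof.
apply: emeasurable_sum => i; apply: emeasurable_funM => //.
exact (measurable_point_count ppp (measurable_level_box _ _ _)).
Qed.

Lemma measurable_arrived a b : measurable_fun setT (fun w => arrived a b w).
Proof.
apply: (@emeasurable_fun_cvg _ _ _ _ (fun r w => arrived_count r a b w)).
  by move=> r; exact: measurable_arrived_count.
by move=> w _; exact: arrived_count_cvg.
Qed.

Let arrived_count_ge0 r a b w : (0 <= arrived_count r a b w)%E.
Proof.
apply: sume_ge0 => i _; rewrite mule_ge0// lee_fin.
exact: size_levels_ge0 sP _ _.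
Qed.

(** Campbell's formula: for rounded sizes it follows from the means of the Poisson counts, and both
    sides pass to the limit by monotone convergence. *)
Lemma arrived_mean a b : a <= b ->
  (\int[P]_w arrived a b w = (t * (b - a))%:E * mean_size nu)%E.
Proof.
move=> ab.
have cvl : (\int[P]_w arrived_count r a b w)%E @[r --> \oo] -->
    (\int[P]_w arrived a b w)%E.
  have -> : (\int[P]_w arrived a b w =
      \int[P]_w limn (fun r => arrived_count r a b w))%E.
    apply: eq_integral => w _; apply/esym/cvg_lim => //.
    exact: arrived_count_cvg.
  apply: cvg_monotone_convergence => //.
  - by move=> r; exact: measurable_arrived_count.
  - by move=> w _; exact: arrived_count_nd.
apply: (cvg_unique _ cvl) => //.
rewrite (_ : (fun r => _) = (fun r => (t * (b - a))%:E *
    \int[nu]_(l in `]0%R, +oo[) (level_fun (s r) l)%:E)%E).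
  by apply: cvgeZl => //; exact: level_fun_integral_cvg.
apply/funext => r; rewrite (level_fun_integral _ sP) /arrived_count.
rewrite ge0_integral_sum//; last 2 first.
- by move=> i; apply: emeasurable_funM => //;
  exact (measurable_point_count ppp (measurable_level_box _ _ _)).
- by move=> i w _; rewrite mule_ge0// lee_fin (size_levels_ge0 sP).
rewrite ge0_sume_distrr; last first.
  by move=> i _; rewrite mule_ge0// lee_fin (size_levels_ge0 sP).
apply: eq_bigr => i _.
rewrite ge0_integralZl_EFin//; last 2 first.
- exact (measurable_point_count ppp (measurable_level_box _ _ _)).
- exact: size_levels_ge0 sP _ _.
rewrite (point_count_mean ppp (measurable_level_box _ _ _) (level_rate_ge0 _
  ab) (level_intensity _ ab)).
rewrite muleCA; congr (_ * _)%E.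
rewrite /level_rate EFinM fineK//.
by rewrite ge0_fin_numE//; exact: size_levels_fin sP _ _.
Qed.

Lemma arrived_ae_fin a b : a <= b ->
  {ae P, forall w, arrived a b w \is a fin_num}.
Proof.
move=> ab; have : P.-integrable setT (fun w => arrived a b w).
  apply/integrableP; split; first exact: measurable_arrived.
  under eq_integral do rewrite gee0_abs ?arrived_size_ge0//.
  rewrite arrived_mean//; apply: lte_mul_pinfty => //.
  by rewrite lee_fin mulr_ge0// subr_ge0.
by move=> /integrable_ae -/(_ measurableT); apply: filterS => w /(_ I).
Qed.

Lemma arrived_num_ae a b : a <= b ->
  {ae P, forall w, forall r, (arrived_num r a b w)%:E = arrived_count r a b w}.
Proof.
move=> ab; apply: ae_foralln => r.
have : {ae P, forall w, forall i : 'I_(level_num (s r)),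
    point_count (R := R) file (level_box a b i) w =
    (point_num (R := R) file (level_box a b i) w)%:R%:E}.
  apply: filter_forall => i.
  exact (point_count_ae ppp (measurable_level_box _ _ _) (level_rate_ge0 _ ab)
    (level_intensity _ ab)).
apply: filterS => w h; rewrite /arrived_num /arrived_count -sumEFin.
by apply: eq_bigr => i _; rewrite EFinM -h.
Qed.

End arrivals.

(** * Unit windows as the steps of the walk *)

Section unit_windows.
Context {R : realType} {d : measure_display} {Omega : measurableType d}.
Variables (P : probability Omega R) (nu : {measure set R -> \bar R}).
Variables (ts xs ls : nat -> Omega -> R) (t : R) (s : nat -> @level R).
Hypothesis ls_gt0 : forall i w, 0 < ls i w.
Hypothesis t_ge0 : 0 <= t.
Hypothesis mean_fin : (mean_size nu < +oo)%E.
Hypothesis sP : size_levels nu s.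

Local Notation file := (fun i w => (ts i w, xs i w, ls i w)).
Hypothesis ppp : is_poisson_point_process P (file_intensity nu) file.

Local Notation arrived a b w :=
  (arrived_size (ts ^~ w) (xs ^~ w) (ls ^~ w) t a b).

Definition window_size (j : nat) (w : Omega) : R :=
  fine (arrived (- j.+1%:R) (- j%:R) w).

Let window_le j : - j.+1%:R <= - j%:R :> R.
Proof. by rewrite lerN2 ler_nat. Qed.

Definition window_nums r j w : {ffun 'I_(level_num (s r)) -> nat} :=
  [ffun i => point_num (R := R) file
     (level_box t (- j.+1%:R) (- j%:R) i) w].

Definition nums_size r (u : {ffun 'I_(level_num (s r)) -> nat}) : R :=
  \sum_(i < level_num (s r)) level_val i * (u i)%:R.

Let y r j w := nums_size (window_nums r j w).

Let yE r j w : y r j w = arrived_num ts xs ls t s r (- j.+1%:R) (- j%:R) w.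
Proof. by apply: eq_bigr => i _; rewrite ffunE. Qed.

Lemma measurable_window_size j : measurable_fun setT (window_size j).
Proof.
apply: (@measurableT_comp _ _ _ _ _ _ (@fine R)) => //.
exact (measurable_arrived t ls_gt0 sP ppp _ _).
Qed.

Lemma window_size_ae : {ae P, forall w, forall j,
  [/\ arrived (- j.+1%:R) (- j%:R) w = (window_size j w)%:E,
   nondecreasing_seq (fun r => y r j w) &
   y r j w @[r --> \oo] --> window_size j w]}.
Proof.
apply: ae_foralln => j.
apply: filterS2 (arrived_ae_fin ls_gt0 t_ge0 mean_fin sP ppp (window_le j))
  (arrived_num_ae t_ge0 sP ppp (window_le j)) => w fin numE.
have aE : arrived (- j.+1%:R) (- j%:R) w = (window_size j w)%:E.
  by rewrite /window_size fineK.
split => //.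
  move=> m n mn; rewrite -lee_fin !yE !numE.
  exact (arrived_count_nd ts xs t ls_gt0 sP _ _ w mn).
suff : (y r j w)%:E @[r --> \oo] --> (window_size j w)%:E by move=> /fine_cvg.
by rewrite -aE; under eq_fun do rewrite yE numE;
  exact (arrived_count_cvg ls_gt0 sP (w := w)).
Qed.

Lemma window_size_mean : \int[P]_w window_size 0 w = t * fine (mean_size nu).
Proof.
rewrite /Rintegral.
rewrite (@ae_eq_integral _ _ _ _ _ (fun w => arrived (- 1%:R) (- 0%:R) w))//.
- rewrite (arrived_mean ls_gt0 t_ge0 sP ppp (window_le 0)).
  rewrite fineM//; last first.
    rewrite ge0_fin_numE//; apply: integral_ge0 => l /=.
    by rewrite in_itv/= andbT lee_fin => /ltW.
  by rewrite /=; ring.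
- apply/measurable_EFinP; exact: measurable_window_size.
- exact (measurable_arrived t ls_gt0 sP ppp _ _).
- by apply: filterS window_size_ae => w /(_ 0%N)[<-].
Qed.

Lemma window_size_integrable j :
  P.-integrable setT (EFin \o window_size j).
Proof.
have mx := measurable_window_size j.
apply/integrableP; split; first exact/measurable_EFinP.
rewrite (@ae_eq_integral _ _ _ _ _
  (fun w => arrived (- j.+1%:R) (- j%:R) w))//.
- rewrite (arrived_mean ls_gt0 t_ge0 sP ppp (window_le j)).
  apply: lte_mul_pinfty => //.
  by rewrite lee_fin mulr_ge0// subr_ge0.
- by apply: measurableT_comp => //; exact/measurable_EFinP.
- exact (measurable_arrived t ls_gt0 sP ppp _ _).
- apply: filterS window_size_ae => w /(_ j)[-> _ _] _ /=.
  by rewrite ger0_norm// fine_ge0// arrived_size_ge0.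
Qed.

(** All windows have length 1, so the rate is free of [j]; stationarity enters here. *)
Let rate r (i : 'I_(level_num (s r))) : R := level_rate nu t 0 1 i.

Let weight r (u : {ffun 'I_(level_num (s r)) -> nat}) : \bar R :=
  (\prod_(i < level_num (s r)) (poisson_weight (rate i) (u i))%:E)%E.

Let box r j (i : 'I_(level_num (s r))) :=
  level_box t (- j.+1%:R) (- j%:R) i.

Let measurable_box r j i : measurable (@box r j i).
Proof. by apply: measurable_file_box; exact: size_levels_measurable sP _ _. Qed.

Let rate_ge0 r (i : 'I_(level_num (s r))) : 0 <= rate i.
Proof. by rewrite /rate /level_rate subr0 mulr1 mulr_ge0// fine_ge0. Qed.

Let box_intensity r j i : file_intensity nu (@box r j i) = (rate i)%:E.
Proof.
rewrite /box /level_box file_intensity_box//; last first.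
  exact: size_levels_measurable sP _ _.
rewrite /rate /level_rate [in RHS]EFinM fineK; last first.
  by rewrite ge0_fin_numE//; exact: size_levels_fin sP _ _.
congr (_%:E * _)%E; congr (_ * _); rewrite -natr1; ring.
Qed.

Let disjoint_boxes r N n :
  trivIset setT (fun ji : 'I_n * 'I_(level_num (s r)) => box (N + ji.1) ji.2).
Proof.
move=> [j i] [j' i'] _ _ [[[u v] l]] [/=]; rewrite /box /level_box /file_box/=.
rewrite !in_itv/= => -[[_ /andP[a1 b1]] Li] [[_ /andP[a2 b2]] Li'].
have -> : i = i'.
  by apply: (size_levels_disjoint sP) => //; exists l.
congr (_, _); apply/val_inj/eqP.
have := lt_le_trans a1 b2; have := lt_le_trans a2 b1.
rewrite !ltrN2 !ltr_nat !ltnS !leq_add2l => jj' j'j.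
by rewrite eqn_leq jj' j'j.
Qed.

Let measurable_window_nums r j u : measurable (window_nums r j @^-1` [set u]).
Proof.
rewrite (_ : _ @^-1` _ = \bigcap_(i in [set: 'I_(level_num (s r))])
    (point_num (R := R) file (box j i) @^-1` [set u i])); last first.
  apply/seteqP; split => w /=.
    by move=> <- i _; rewrite /window_nums /= ffunE.
  by move=> h; apply/ffunP => i; rewrite ffunE h.
apply: fin_bigcap_measurable => // i _.
exact (measurable_point_num ppp _ (measurable_box j i)).
Qed.

Let block_window_nums r N n (v : {ffun 'I_n -> {ffun 'I_(level_num (s r)) ->
  nat}}) :
  P (block (window_nums r) N n @^-1` [set v]) = (\prod_(j < n) weight (v j))%E.
Proof.
have := point_num_indep ppp (fun ji : 'I_n * 'I_(level_num (s r)) => v ji.1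
  ji.2)
  (fun ji => measurable_box (N + ji.1) ji.2) (@disjoint_boxes r N n)
  (fun ji => rate_ge0 ji.2) (fun ji => box_intensity (N + ji.1) ji.2).
rewrite /weight pair_bigA/= => <-; congr (P _); apply/seteqP; split => w /=.
  by move=> <- [j i] _ /=; rewrite /block /window_nums !ffunE.
move=> h; apply/ffunP => j; apply/ffunP => i;
  rewrite /block /window_nums !ffunE.
exact: (h (j, i)).
Qed.

(** A positive mean size yields a level of positive value [v] and positive mass. More than [c / v]
    files of that level in the window make it exceed [c], and a Poisson count of positive rate takes
    every value with positive probability. *)
Lemma window_size_gt c : 0 < t -> (0 < mean_size nu)%E ->
  P [set w | c < window_size 0 w] <> 0%E.
Proof.
move=> t_gt0 m_gt0 Pc0.
have [r [i [v_gt0 L_gt0]]] : exists r (i : 'I_(level_num (s r))),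
    0 < level_val i /\ (0 < nu (level_set i))%E.
  apply: contrapT => /forallNP h; move: m_gt0; rewrite ltNge => /negP; apply.
  rewrite -(cvg_lim _ (level_fun_integral_cvg sP))//.
  apply: lime_le; first by apply/cvg_ex; eexists; exact: level_fun_integral_cvg.
  apply: nearW => r; rewrite (level_fun_integral _ sP) big1// => i _.
  have /forallNP/(_ i) := h r.
  have := size_levels_ge0 sP i; rewrite le_eqVlt => /predU1P[<-|v0].
    by rewrite mul0e.
  have := measure_ge0 nu (level_set i); rewrite le_eqVlt => /predU1P[<-|L0].
    by rewrite mule0.
  by move=> /not_andP[].
have rate_gt0 : 0 < rate i.
  rewrite /rate /level_rate subr0 mulr1 mulr_gt0// fine_gt0// L_gt0.
  exact: size_levels_fin sP _ _.
pose k := (Num.truncn (c / level_val i)).+1.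
have ck : c < level_val i * k%:R.
  by rewrite mulrC -ltr_pdivrMr//; exact: truncnS_gt.
have := point_num_law ppp k (measurable_box 0 i) (rate_ge0 i) (box_intensity 0
  i).
suff -> : P (point_num (R := R) file (box 0 i) @^-1` [set k]) = 0%E.
  move=> -[] /esym/eqP; rewrite /poisson_weight !mulf_eq0 invr_eq0.
  rewrite gt_eqF ?expR_gt0//= expf_eq0 (gt_eqF rate_gt0) andbF/=.
  by rewrite pnatr_eq0 gtn_eqF// fact_gt0.
have [A [mA PA0 hA]] := window_size_ae.
have mX : measurable [set w | c < window_size 0 w].
  rewrite -[X in measurable X]setTI.
  rewrite (_ : [set w | _] = window_size 0 @^-1` `]c, +oo[).
    exact: measurable_window_size.
  by apply/seteqP; split => w /=; rewrite in_itv/= andbT.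
apply: (@subset_measure0 _ _ _ P _ (A `|` [set w | c < window_size 0 w])).
- exact (measurable_point_num ppp _ (measurable_box 0 i)).
- exact: measurableU.
- move=> w /= Nk; apply/or_asboolP; rewrite orbC -implyNb;
  apply/implyP => /asboolP nc.
  apply/asboolP; apply: hA => /(_ 0%N)[_ nd cv]; apply: nc.
  apply: (lt_le_trans ck); apply: (@le_trans _ _ (y r 0 w)).
    rewrite /y /nums_size (bigD1 i)//= ffunE -[level_box _ _ _ _]/(box 0 i) Nk
      lerDl.
    by apply: sumr_ge0 => i' _; rewrite mulr_ge0// (size_levels_ge0 sP).
  rewrite -(cvg_lim _ cv)//; apply: nondecreasing_cvgn_le => //.
  by apply/cvg_ex; eexists; exact: cv.
- by apply: etrans PA0; exact: measureU0.
Qed.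

Section walk_laws.
Variable c : R.

(** Turns a block into a sequence for [lindley]. The padding 0 is never read: [n] steps from time 0
    use only the entries below [n]. *)
Let ext r n (v : {ffun 'I_n -> {ffun 'I_(level_num (s r)) -> nat}}) (j : nat)
  : R :=
  if insub j is Some i then nums_size (v i) else 0.

Let lindley_block r n N w :
  lindley c (fun j => y r j w) n N = lindley c (ext (block (window_nums r) N n
    w)) n 0.
Proof.
apply: eq_lindley => j jn; rewrite add0n /ext insubT/= /block ffunE.
by rewrite /y /=.
Qed.

Let E r n N k := [set w | k < lindley c (fun j => y r j w) n N].
Let G r n k := [set v : {ffun 'I_n -> {ffun 'I_(level_num (s r)) -> nat}} |
  k < lindley c (ext v) n 0].

Let E_block r n N k : E r n N k = block (window_nums r) N n @^-1` @G r n k.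
Proof. by apply/seteqP; split => w; rewrite /E /G /= lindley_block. Qed.

Let measurable_E r n N k : measurable (E r n N k).
Proof.
rewrite E_block; apply: measurable_preimage_countable => v.
by apply: measurable_block => j u; exact: measurable_window_nums.
Qed.

Let E_cvg n N k : {ae P, forall w, \forall r \near \oo,
  E r n N k w <-> [set w | k < lindley c (window_size ^~ w) n N] w}.
Proof.
apply: filterS window_size_ae => w h; rewrite /E /=.
apply: lt_nd_cvg.
  by move=> r r' rr'; apply: lindley_le => j; have [_ + _] := h j; apply.
by apply: lindley_cvg => j; have [_ _] := h j.
Qed.

Let measurable_W n N k :
  measurable [set w | k < lindley c (window_size ^~ w) n N].
Proof. by apply: measurable_lt_lindley => j; exact: measurable_window_size. Qed.

Lemma window_lindley_law n k :
  P [set w | k < lindley c (window_size ^~ w) n 1] =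
  P [set w | k < lindley c (window_size ^~ w) n 0].
Proof.
have c1 := measure_cvg_ae (fun r => measurable_E r n 1 k)
  (measurable_W n 1 k) (E_cvg n 1 k).
have c0 := measure_cvg_ae (fun r => measurable_E r n 0 k)
  (measurable_W n 0 k) (E_cvg n 0 k).
rewrite (_ : (fun r => _) = (fun r => P (E r n 1 k))) in c0.
  exact: cvg_unique c1 c0.
apply/funext => r; rewrite !E_block; symmetry.
exact: (block_stationary (@measurable_window_nums r) (@block_window_nums r)).
Qed.

Lemma window_lindley_indep N n k k' :
  independent_events P [set w | k < lindley c (window_size ^~ w) N 0]
    [set w | k' < lindley c (window_size ^~ w) n N].
Proof.
apply: (@independent_events_cvg_ae _ _ _ P (fun r => E r N 0 k)
  (fun r => E r n N k')) => //.
move=> r; rewrite !E_block.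
exact: (block_independent (@measurable_window_nums r) (@block_window_nums r)).
Qed.

(** The first window is treated as a block of length 1, followed by the block from time 1 on. *)
Lemma window_size_indep n a k :
  independent_events P [set w | a < window_size 0 w]
    [set w | k < lindley c (window_size ^~ w) n 1].
Proof.
pose F r := block (window_nums r) 0 1 @^-1`
  [set v : {ffun 'I_1 -> {ffun 'I_(level_num (s r)) -> nat}} |
    a < nums_size (v ord0)].
have FE r w : F r w <-> a < y r 0 w by rewrite /F /= /block ffunE.
apply: (@independent_events_cvg_ae _ _ _ P F (fun r => E r n 1 k)) => //.
- move=> r; apply: measurable_preimage_countable => v.
  by apply: measurable_block => j u; exact: measurable_window_nums.
- rewrite -[X in measurable X]setTI.
  rewrite (_ : [set w | _] = window_size 0 @^-1` `]a, +oo[).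
    exact: measurable_window_size.
  by apply/seteqP; split => w /=; rewrite in_itv/= andbT.
- apply: filterS window_size_ae => w /(_ 0%N)[_ nd cv].
  by apply: filterS (lt_nd_cvg a nd cv) => r; rewrite FE.
- move=> r; rewrite E_block.
  exact: (block_independent (@measurable_window_nums r) (@block_window_nums r)).
Qed.

End walk_laws.

End unit_windows.

(** * Passage to the theorem *)

Lemma mean_size_gt0 {R : realType} (nu : {measure set R -> \bar R}) :
  nu `]-oo, 0]%classic = 0%E -> nu [set: R] <> 0%E -> (0 < mean_size nu)%E.
Proof.
move=> nu0 nuT; pose D : set R := `]0, +oo[%classic.
have mD : measurable D by exact: measurable_itv.
have D0 l : D l -> 0 < l by rewrite /D/= in_itv/= andbT.
have mE : measurable_fun D (EFin : R -> \bar R).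
  exact/measurable_EFinP/measurable_id.
rewrite lt_neqAle; apply/andP; split; last first.
  by apply: integral_ge0 => l /D0 /ltW; rewrite lee_fin.
apply/eqP => /esym m0; apply: nuT.
have /(ae_eq_integral_abs nu mD mE)[A [mA A0 hA]] :
    (\int[nu]_(l in D) `|l%:E| = 0)%E.
  by rewrite -m0; apply: eq_integral => l /[!inE] /D0 l0;
    rewrite gee0_abs// lee_fin ltW.
apply: (@subset_measure0 _ _ _ nu _ (A `|` `]-oo, 0]%classic)) => //.
- by apply: measurableU => //; exact: measurable_itv.
- move=> l _; have [l0|l0] := leP l 0; [right|left].
    by rewrite /= in_itv.
  apply: hA => /= h.
  have /h [] : D l by rewrite /D/= in_itv/= andbT.
  by move=> l0'; move: l0; rewrite l0' ltxx.
- by apply: etrans A0; exact: measureU0 (measurable_itv _) _.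
Qed.

(** Reduces all intervals to countably many, so that one null set serves every [a] and [b]. *)
Lemma arrived_size_fin_itv {R : realType} (ts xs ls : nat -> R) (t : R) :
  (forall i, 0 < ls i) ->
  (forall n : nat, arrived_size ts xs ls t (- n%:R) n%:R \is a fin_num) ->
  forall a b, arrived_size ts xs ls t a b \is a fin_num.
Proof.
move=> l0 fin a b.
pose n := (Num.truncn (Num.max `|a| `|b|)).+1.
have : Num.max `|a| `|b| < n%:R by exact: truncnS_gt.
rewrite gt_max => /andP[an bn].
have := ler_norm (- a); rewrite normrN => na.
have bb := ler_norm b.
have [ab|ba] := leP a b; last first.
  rewrite /arrived_size (_ : [set i | _] = set0) ?esum_set0//.
  apply/seteqP; split => // i /= [_ /andP[h1 h2]].
  by move: (lt_le_trans h1 h2); rewrite ltNge (ltW ba).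
move: (fin n); rewrite !ge0_fin_numE ?arrived_size_ge0//.
apply: le_lt_trans.
have na' : - n%:R <= a by lra.
have bn' : b <= n%:R by lra.
rewrite (arrived_sizeD _ _ _ l0 na' (le_trans ab bn')).
rewrite (arrived_sizeD _ _ _ l0 ab bn') addeCA.
by rewrite leeDl// adde_ge0// arrived_size_ge0.
Qed.

Unset Implicit Arguments.

Theorem proposition2 (R : realType) (d : measure_display)
    (Omega : measurableType d) (P : probability Omega R)
    (nu : {measure set R -> \bar R})
    (ts xs ls : nat -> {RV P >-> R})
    (nu_pos : nu `]-oo, 0]%classic = 0%E)
    (nu_neq0 : nu [set: R] <> 0%E)
    (m_fin : (mean_size nu < +oo)%E)
    (ts_ge0 : forall i w, 0 <= ts i w)
    (ls_gt0 : forall i w, 0 < ls i w)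
    (files_ppp : is_poisson_point_process P (file_intensity nu)
       (fun i w => (ts i w, xs i w, ls i w))) :
  (forall t : R, 0 <= t -> t < (fine (mean_size nu))^-1 ->
     {ae P, forall w,
       covering (ts ^~ w) (xs ^~ w) (ls ^~ w) t =
         [set x : R | (load_inf (ts ^~ w) (xs ^~ w) (ls ^~ w) t x <
                       (load (ts ^~ w) (xs ^~ w) (ls ^~ w) t x)%:E)%E] /\
       covering (ts ^~ w) (xs ^~ w) (ls ^~ w) t <> [set: R]}) /\
  (forall t : R, (fine (mean_size nu))^-1 <= t ->
     {ae P, forall w,
       covering (ts ^~ w) (xs ^~ w) (ls ^~ w) t = [set: R]}).
Proof.
have [s sP] := size_levels_exist m_fin.
have lsw0 w i : 0 < ls i w by exact: ls_gt0.
have m_gt0 := mean_size_gt0 nu_pos nu_neq0.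
set m := fine (mean_size nu).
have m0 : 0 < m by rewrite fine_gt0// m_gt0.
have fin t : 0 <= t -> {ae P, forall w, forall a b,
    arrived_size (ts ^~ w) (xs ^~ w) (ls ^~ w) t a b \is a fin_num}.
  move=> t0; have /ae_foralln : forall n : nat, {ae P, forall w,
      arrived_size (ts ^~ w) (xs ^~ w) (ls ^~ w) t (- n%:R) n%:R \is a fin_num}.
    move=> n; apply: (arrived_ae_fin ls_gt0 t0 m_fin sP files_ppp).
    by rewrite (@le_trans _ _ 0)// oppr_le0.
  by apply: filterS => w h; apply: arrived_size_fin_itv.
pose X t j w := window_size ts xs ls t j w.
have sumX t w n : 
    (forall a b, arrived_size (ts ^~ w) (xs ^~ w) (ls ^~ w) t a b \is a
      fin_num) ->
    fine (arrived_size (ts ^~ w) (xs ^~ w) (ls ^~ w) t (- n%:R) 0) =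
    \sum_(j < n) X t (0 + j)%N w.
  by move=> finw; rewrite (fine_arrived_sum (lsw0 w) finw).
split=> t.
  move=> t0 tm; have tm1 : t * m < 1 by rewrite -ltr_pdivlMr// div1r.
  (* Any value strictly between [t * m] and 1 would do: above [t * m] the walk is bounded, and below
     1 the load keeps a linear growth towards [-oo]. *)
  pose c := (t * m + 1) / 2.
  have c0 : 0 <= c.
    by rewrite /c; have : 0 <= t * m := mulr_ge0 t0 (ltW m0); lra.
  have c1 : c < 1 by rewrite /c; lra.
  have := @walk_bounded _ _ _ P c (X t)
    (measurable_window_size t ls_gt0 sP files_ppp)
    (window_size_integrable ls_gt0 t0 m_fin sP files_ppp)
    (window_lindley_law ls_gt0 t0 m_fin sP files_ppp c)
    (window_lindley_indep ls_gt0 t0 m_fin sP files_ppp c).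
  rewrite (window_size_mean ls_gt0 t0 m_fin sP files_ppp) -/m => PU.
  have {PU} bounded : {ae P, forall w, lindley_sup c (X t ^~ w) 0 <> +oo%E}.
    exists [set w | lindley_sup c (X t ^~ w) 0 = +oo%E]; split.
    - exact (measurable_unbounded c
        (measurable_window_size t ls_gt0 sP files_ppp)).
    - by apply: PU; rewrite /c; lra.
    - by move=> w /contrapT.
  apply: filterS2 bounded (fin t t0) => w bw finw; split.
    exact: covering_load.
  have [K SK] : exists K, forall n, lindley c (X t ^~ w) n 0 <= K.
    exists (fine (lindley_sup c (X t ^~ w) 0)) => n.
    have := lindley_le_sup c (X t ^~ w) n 0.
    have := lindley_sup_ge0 c (X t ^~ w) 0.
    move: bw; case: (lindley_sup c (X t ^~ w) 0) => [r _ _|//|//].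
    by rewrite lee_fin.
  apply: (@covering_neqT _ _ _ _ _ (lsw0 w) finw c K c0 c1) => n.
  rewrite sumX//; have := le_trans (lindley_ge_sum c (X t ^~ w) n 0) (SK n).
  by rewrite lerBlDr; apply.
move=> mt; have t_gt0 : 0 < t by apply: lt_le_trans mt; rewrite invr_gt0.
have t0 := ltW t_gt0.
have tm1 : 1 <= t * m by rewrite -ler_pdivrMr// div1r.
(* In the critical case the steps have mean exactly 1, and [window_size_gt] supplies the chance of a
   step above 1, without which the walk could be identically 0. *)
have := @walk_unbounded _ _ _ P 1 (X t)
  (measurable_window_size t ls_gt0 sP files_ppp)
  (window_size_integrable ls_gt0 t0 m_fin sP files_ppp)
  (window_lindley_law ls_gt0 t0 m_fin sP files_ppp 1)
  (window_lindley_indep ls_gt0 t0 m_fin sP files_ppp 1)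
  (window_size_indep ls_gt0 t0 m_fin sP files_ppp 1).
rewrite (window_size_mean ls_gt0 t0 m_fin sP files_ppp) -/m => PU.
have mU := measurable_unbounded 1
  (measurable_window_size t ls_gt0 sP files_ppp).
have {PU} unbounded : {ae P, forall w, lindley_sup 1 (X t ^~ w) 0 = +oo%E}.
  exists (~` [set w | lindley_sup 1 (X t ^~ w) 0 = +oo%E]); split => //.
    exact: measurableC.
  rewrite probability_setC// PU// ?subee//.
  exact: (window_size_gt ls_gt0 t0 m_fin sP files_ppp).
apply: filterS2 unbounded (fin t t0) => w uw finw.
apply: (covering_eqT (lsw0 w) finw) => K.
have [|n] := (lt_lindley_sup 1 (X t ^~ w) 0 K%:E).1; first by rewrite uw ltry.
rewrite lte_fin; have [k ->] := lindley_sum 1 (X t ^~ w) n 0 => Kk.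
by exists k; rewrite sumX//; lra.
Qed.
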